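(* Let $\nu$ be a finite positive Borel measure on $[0,\infty)$ and let $$g(t)=\int_0^\infty\cos(tu)\,\nu(du),\qquad t\in[0,\infty).$$ Suppose that the support of $\nu$ is separated from the origin, i.e. $\operatorname{supp}\nu\subset[a,\infty)$ for some $a>0$. Assume further that $$l(\nu):=\limsup_{r\to\infty}|h(r)|>0,\qquad h(r):=\frac1{2\pi^{3/2}}\int_0^\infty\frac{\cos\left(2rs-\frac\pi4\right)}{\sqrt s}\,\nu(ds).$$ Then $\kappa_2^-(g)=+\infty$.
   Context: For a real-valued continuous function $g$ on $[0,\infty)$ and a finite set $X=\{x_j\}_{j=1}^N\subset\mathbb{R}^n$ of distinct points, $\kappa^-(g,X)$ denotes the number of negative eigenvalues, counting multiplicity, of the Schoenberg matrix $\|g(|x_i-x_j|)\|_{i,j=1}^N$ ($|\cdot|$ the Euclidean norm), and $$\kappa_n^-(g)=\sup\{\kappa^-(g,X): X \text{ a finite subset of } \mathbb{R}^n\}.$$ *)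

(* Defs.v *)
From HB Require Import structures.
From mathcomp Require Import all_boot all_order all_algebra.
From mathcomp Require Import all_classical all_reals all_analysis.

Set Implicit Arguments.
Unset Strict Implicit.
Unset Printing Implicit Defensive.

Import Order.TTheory GRing.Theory Num.Theory.
Import numFieldNormedType.Exports.

Local Open Scope classical_set_scope.
Local Open Scope ring_scope.

(* The library norm on 'rV[R]_n is the sup norm. *)
Definition euclidean_norm (R : realType) (n : nat) (x : 'rV[R]_n) : R :=
  Num.sqrt (\sum_(k < n) x ord0 k ^+ 2).

Definition schoenberg_mx (R : realType) (g : R -> R) (n N : nat)
    (x : 'I_N -> 'rV[R]_n) : 'M[R]_N :=
  \matrix_(i, j) g (euclidean_norm (x i - x j)).

(* A finitely supported sum over the negative eigenvalues, each weighted by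
   its multiplicity as a root of the characteristic polynomial. *)
Definition num_neg_eigenvalues (R : realType) (N : nat) (A : 'M[R]_N) : nat :=
  (\sum_(a \in [set a : R | eigenvalue A a /\ (a < 0)%R]) mup a (char_poly A))%N.

(* A finite set of points is represented by an enumeration without repetition;
   reordering the points permutes the matrix by a similarity. *)
Definition kappa_minus (R : realType) (n : nat) (g : R -> R) : \bar R :=
  ereal_sup [set k | exists (N : nat) (x : 'I_N -> 'rV[R]_n),
    injective x /\ k = ((num_neg_eigenvalues (schoenberg_mx g x))%:R)%:E].

Definition measure_support (R : realType)
    (nu : {measure set (measurableTypeR R) -> \bar R}) : set R :=
  [set x : R | forall U : set R, open U -> U x -> (0 < nu U)%E].

(* Measures on [0, +oo) are represented by Borel measures on R for which the
   negative half-line is null.  At s = 0 the integrand is 0 by the convention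
   0^-1 = 0, which is harmless when 0 lies outside the support. *)
Definition h_transform (R : realType)
    (nu : {measure set (measurableTypeR R) -> \bar R}) (r : R) : R :=
  (2 * (pi : R) `^ (3 / 2))^-1 *
  \int[nu]_(s in `[0, +oo[) (cos (2 * r * s - pi / 4) / Num.sqrt s).

Definition l_limsup (R : realType)
    (nu : {measure set (measurableTypeR R) -> \bar R}) : \bar R :=
  limf_esup (fun r : R => `|h_transform nu r|%:E) (pinfty_nbhs R).

(* Main.v *)
Require Import Defs.
From HB Require Import structures.
From mathcomp Require Import all_boot all_order all_algebra.
From mathcomp Require Import all_classical all_reals all_analysis.
From mathcomp Require Import finmap measurable_realfun ring lra zify.

(** Points are placed at the vertices of a regular polygon with [n + 1] vertices
inscribed in a circle of radius [r].  Their Schoenberg matrix is circulant and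
symmetric, so the vectors [cos (2 k pi j / (n + 1))] are eigenvectors, and the
eigenvalues are the cosine coefficients of the chord function
[p |-> g (2 r sin p)] sampled at [n + 1] nodes.  As [n] grows these
coefficients, suitably scaled, converge to
[int_0^pi g (2 r sin p) cos (2 k p) dp = pi int J_2k (2 r u) nu(du)],
where [J_2k] is a Bessel function (lemma [coefficient_cvg]).

For large arguments [J_2k (z)] equals, up to [O (1 / z)],
[(-1)^k] times a nonzero constant times [cos (z - pi / 4) / sqrt z]
(lemma [bessel_asymptotics]).  Since [nu] lives on [u >= a > 0], the integral
[int J_2k (2 r u) nu(du)] is [(-1)^k] times a constant times
[h r / sqrt r], with an error [O (1 / r)] that is uniform for [k] in a finite
range.  The hypothesis on [limsup |h|] provides arbitrarily large [r] for which
the main term dominates; for such an [r] all indices [k] of one parity, in a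
range as long as desired, give negative eigenvalues
(lemma [bessel_integral_negative]).  Choosing [n] afterwards produces
arbitrarily many independent eigenvectors with negative eigenvalues
(lemma [polygon_negative]), and these are counted with multiplicity by the
characteristic polynomial (lemma [num_neg_eigenvalues_ge]).

The Bessel asymptotics come in two steps.  The identity
[J_2k + J_(2k+2) = O (1 / z)] reduces everything to [k = 0].  There the phase is
stationary at [p = pi / 2], and after the change of variables
[p = pi / 2 + 2 t] a comparison with Fresnel integrals leaves an error
[O (1 / z)].  That the two Fresnel integrals have the same nonzero limit, which
is what produces the phase shift [pi / 4], follows by squaring
[int_0^x e^(i t^2) dt] (lemma [fresnel_identity]). *)

Import Order.TTheory GRing.Theory Num.Theory.
Import numFieldNormedType.Exports.

Local Open Scope classical_set_scope.
Local Open Scope ring_scope.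

Set Implicit Arguments.
Unset Strict Implicit.
Unset Printing Implicit Defensive.

(** * Derivatives and primitives on the real line *)

Section Derivatives.
Variable R : realType.
Implicit Types (f g F : R -> R) (x d e : R).

Lemma der_eq f x d e : is_derive x (1 : R) f d -> d = e ->
  is_derive x (1 : R) f e.
Proof. by move=> df <-. Qed.

Lemma der_cst (c x : R) : is_derive x (1 : R) (fun=> c) 0.
Proof. exact: is_derive_cst. Qed.

Lemma der_id x : is_derive x (1 : R) (fun y => y) 1.
Proof. exact: is_derive_id. Qed.

Lemma der_add f g x d e : is_derive x (1 : R) f d -> is_derive x (1 : R) g e ->
  is_derive x (1 : R) (fun y => f y + g y) (d + e).
Proof. exact: is_deriveD. Qed.

Lemma der_opp f x d : is_derive x (1 : R) f d ->
  is_derive x (1 : R) (fun y => - f y) (- d).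
Proof. exact: is_deriveN. Qed.

Lemma der_mul f g x d e : is_derive x (1 : R) f d -> is_derive x (1 : R) g e ->
  is_derive x (1 : R) (fun y => f y * g y) (f x * e + g x * d).
Proof. exact: is_deriveM. Qed.

Lemma der_comp F f x d e : is_derive x (1 : R) f d -> is_derive (f x) (1 : R) F e ->
  is_derive x (1 : R) (fun y => F (f y)) (d * e).
Proof. by move=> df dF; rewrite mulrC; exact: is_derive1_comp. Qed.

Lemma der_sin f x d : is_derive x (1 : R) f d ->
  is_derive x (1 : R) (fun y => sin (f y)) (d * cos (f x)).
Proof. by move=> df; apply: der_comp; exact: is_derive_sin. Qed.

Lemma der_cos f x d : is_derive x (1 : R) f d ->
  is_derive x (1 : R) (fun y => cos (f y)) (d * - sin (f x)).
Proof. by move=> df; apply: der_comp; exact: is_derive_cos. Qed.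

Lemma der_sqr f x d : is_derive x (1 : R) f d ->
  is_derive x (1 : R) (fun y => f y ^+ 2) (2 * f x * d).
Proof.
by move=> df; eapply der_eq; [exact (der_mul df df)|ring].
Qed.

Lemma der_inv f x d : f x != 0 -> is_derive x (1 : R) f d ->
  is_derive x (1 : R) (fun y => (f y)^-1) (- (f x) ^- 2 * d).
Proof.
move=> f0 df.
exact: (is_deriveV f0 df).
Qed.

Lemma der_cont F x d : is_derive x (1 : R) F d -> {for x, continuous F}.
Proof.
move=> [dF _]; apply: differentiable_continuous.
exact/derivable1_diffP.
Qed.

Lemma der_ge0 F f (a b : R) : a <= b ->
  (forall x, a <= x <= b -> is_derive x (1 : R) F (f x)) ->
  (forall x, a <= x <= b -> 0 <= f x) -> F a <= F b.
Proof.
move=> ab dF f0.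
have [x xab| |c cab E] := @MVT_segment R F f a b ab.
- by apply: dF; rewrite !(itvP xab).
- apply: derivable_within_continuous => x xab.
  by have [] : is_derive x 1 F (f x) by apply: dF; rewrite !(itvP xab).
by rewrite -subr_ge0 E mulr_ge0 ?subr_ge0// f0// !(itvP cab).
Qed.

(** The mean value inequality with a varying bound: integrating the bound, rather
than taking its supremum, is what keeps the integrals of [1 / s^2] below small. *)
Lemma der_dom F f G g (a b : R) : a <= b ->
  (forall x, a <= x <= b -> is_derive x (1 : R) F (f x)) ->
  (forall x, a <= x <= b -> is_derive x (1 : R) G (g x)) ->
  (forall x, a <= x <= b -> `|f x| <= g x) -> `|F b - F a| <= G b - G a.
Proof.
move=> ab dF dG fg.
have H1 : G a - F a <= G b - F b.
  apply: (@der_ge0 (fun x => G x - F x) (fun x => g x - f x)) => // x xab.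
    exact: der_add (dG _ xab) (der_opp (dF _ xab)).
  by have := fg _ xab; rewrite ler_norml; lra.
have H2 : G a + F a <= G b + F b.
  apply: (@der_ge0 (fun x => G x + F x) (fun x => g x + f x)) => // x xab.
    exact: der_add (dG _ xab) (dF _ xab).
  by have := fg _ xab; rewrite ler_norml; lra.
by rewrite ler_norml; lra.
Qed.

Lemma der_bound F f (a b M : R) : a <= b ->
  (forall x, a <= x <= b -> is_derive x (1 : R) F (f x)) ->
  (forall x, a <= x <= b -> `|f x| <= M) ->
  `|F b - F a| <= M * (b - a).
Proof.
move=> ab dF fM; rewrite mulrBr.
apply: (@der_dom F f (fun x => M * x) (fun=> M)) => // x _.
by eapply der_eq; [exact: der_mul (der_cst M x) (der_id x)|cbv beta; ring].
Qed.

(** Stated on a half-line because the primitives first constructed below are only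
differentiable to the right of their base point. *)
Lemma der0_eq F (c a b : R) : c < a -> c < b ->
  (forall x, c < x -> is_derive x (1 : R) F 0) -> F a = F b.
Proof.
move=> ca cb dF; wlog ab : a b ca cb / a <= b.
  by move=> H; have [/H->|/ltW/H->] := leP a b.
have dF' x : a <= x <= b -> is_derive x (1 : R) F 0.
  by move=> /andP[ax _]; apply/dF/(lt_le_trans ca).
have := @der_bound F (fun=> 0) a b 0 ab dF'.
rewrite normr0 mul0r => /(_ (fun _ _ => lexx 0)).
by rewrite normr_le0 subr_eq0 => /eqP.
Qed.
End Derivatives.

(** Computes the derivative of an explicit function from the pointwise rules above,
leaving the equation with the announced derivative. *)
Ltac der_step := first
  [ eassumption | eapply der_cst | eapply der_id | eapply der_add | eapply der_opp
  | eapply der_sqr | eapply der_mul | eapply der_sin | eapply der_cos ].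
Ltac der_tac := eapply der_eq; [repeat der_step|cbv beta].

Section Primitives.
Variable R : realType.
Implicit Types (f g F : R -> R) (x d e : R).

(** The increment [F b - F a] of a primitive stands for the integral of [f] from
[a] to [b]: additivity, substitution and integration by parts then become
computations of derivatives. *)
Definition primitive_of f F := forall x, is_derive x (1 : R) F (f x).

Lemma primitive_right f (a : R) : continuous f ->
  exists F, forall x, a < x -> is_derive x (1 : R) F (f x).
Proof.
move=> cf.
exists (fun x => \int[lebesgue_measure]_(t in `[a, x]) f t) => x ax.
have [] := @continuous_FTC1_closed R f a x (x + 1) _ _ ax (cf x).
- by rewrite ltrDl.
- apply: continuous_compact_integrable; first exact: segment_compact.
  exact: continuous_subspaceT.
by move=> dF <-; rewrite derive1E; exact: derivableP.
Qed.

(** An integral from a base point is differentiable only to the right of that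
point.  A base point that moves with [x], together with a normalization at [0],
glues these local primitives into a global one, since two of them differ by a
constant. *)
Lemma primitive_exists f : continuous f -> exists F, primitive_of f F.
Proof.
move=> cf.
have [P dP] := choice (fun a => primitive_right a cf).
exists (fun x => P (- `|x| - 1) x - P (- `|x| - 1) 0) => x.
pose b := - `|x| - 2.
have bx : b < x by rewrite /b; have := lerNnormlW (lexx `|x|); lra.
have b0 : b < 0 by rewrite /b; have := normr_ge0 x; lra.
have dPb : is_derive x 1 (fun y => P b y - P b 0) (f x).
  by eapply der_eq; [eapply der_add; [exact: dP|eapply der_cst]|rewrite addr0].
apply: near_eq_is_derive dPb.
near=> y.
have yb : `|y| < `|x| + 1.
  have : `|y - x| < 1.
    rewrite distrC; near: y.
    by apply: (@cvgr_dist_lt _ _ _ (nbhs x) _ id x (@cvg_id _ _)).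
  by have := ler_normD (y - x) x; rewrite subrK; lra.
pose a := - `|y| - 1.
have ba : b < a by rewrite /b /a; lra.
have ay : a < y by rewrite /a; have := lerNnormlW (lexx `|y|); lra.
have a0 : a < 0 by rewrite /a; have := normr_ge0 y; lra.
have := @der0_eq R (fun t => P a t - P b t) a y 0 ay a0.
move=> H; suff /H : forall t, a < t -> is_derive t 1 (fun u => P a u - P b u) 0.
  by rewrite -/a; lra.
move=> t at_; eapply der_eq.
  eapply der_add; first exact: dP.
  by eapply der_opp; apply: dP; exact: lt_trans at_.
by rewrite subrr.
Unshelve. all: by end_near.
Qed.
End Primitives.

(** * Differentiation under the integral sign *)

Section Leibniz.
Variable R : realType.
Implicit Types (F : R -> R).

Lemma der_quadratic F (x d K : R) :
  (forall y, `|y - x| <= 1 -> `|F y - F x - (y - x) * d| <= K * (y - x) ^+ 2) ->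
  is_derive x (1 : R) F d.
Proof.
move=> FK.
have K0 : 0 <= K.
  have := FK (x + 1); rewrite (_ : x + 1 - x = 1); last ring.
  by rewrite normr1 expr1n mulr1 => /(_ (lexx 1)); apply: le_trans.
have H : (fun h => h^-1 *: (F (h *: 1 + x) - F x)) @ (0 : R)^' --> d.
  apply/cvgrPdist_le => e e0; near=> h.
  have h0 : h != 0 by near: h; exact: nbhs_dnbhs_neq.
  have h1 : `|h| <= 1 by near: h; apply: dnbhs0_le.
  have he : `|h| <= e / (K + 1) by near: h; apply: dnbhs0_le; rewrite divr_gt0// ltr_wpDl.
  have := FK (h + x); rewrite addrK => /(_ h1) Fh.
  rewrite [_ *: 1]mulr1 /GRing.scale/=.
  rewrite (_ : d - _ = - (h^-1 * (F (h + x) - F x - h * d))); last by field.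
  rewrite normrN normrM normfV ler_pdivrMl ?normr_gt0//.
  apply: (le_trans Fh); rewrite -real_normK ?num_real// expr2 mulrA mulrC ler_wpM2l//.
  have : `|h| * (K + 1) <= e by rewrite -ler_pdivlMr// ltr_wpDl.
  by have := normr_ge0 h; nra.
apply: DeriveDef; first by apply/cvg_ex; exists d.
exact: cvg_lim H.
Unshelve. all: by end_near. Qed.

(** The remainder is the increment of [u |-> f u - u * f1 x], whose derivative
[f1 u - f1 x] is itself of first order. *)
Lemma taylor2 (f f1 f2 : R -> R) (x y K : R) :
  (forall u, is_derive u (1 : R) f (f1 u)) ->
  (forall u, is_derive u (1 : R) f1 (f2 u)) ->
  (forall u, `|u - x| <= `|y - x| -> `|f2 u| <= K) ->
  `|f y - f x - (y - x) * f1 x| <= K * (y - x) ^+ 2.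
Proof.
move=> df df1 f2K.
have K0 : 0 <= K by apply: le_trans (f2K x _); rewrite ?subrr ?normr0.
have near1 u : `|u - x| <= `|y - x| -> `|f1 u - f1 x| <= K * `|y - x|.
  move=> uyx; have [xu|/ltW ux] := leP x u.
    apply: le_trans (_ : K * (u - x) <= _); last first.
      by rewrite ler_wpM2l// (le_trans (ler_norm _) uyx).
    apply: der_bound => // v /andP[xv vu]; apply: f2K.
    by apply: le_trans uyx; rewrite !ger0_norm ?subr_ge0// lerB.
  rewrite distrC; apply: le_trans (_ : K * (x - u) <= _); last first.
    by rewrite ler_wpM2l// (le_trans (ler_norm _))// distrC.
  apply: der_bound => // v /andP[uv vx]; apply: f2K.
  by apply: le_trans uyx; rewrite ![ `|_ - x|]distrC !ger0_norm ?subr_ge0// lerB.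
have dg u : is_derive u (1 : R) (fun u => f u - u * f1 x) (f1 u - f1 x).
  have ? := df u; have ? := df1 u.
  der_tac; ring.
rewrite -real_normK ?num_real// expr2 mulrA.
rewrite (_ : f y - f x - _ = (f y - y * f1 x) - (f x - x * f1 x)); last by ring.
have [xy|/ltW yx] := leP x y.
  rewrite [X in _ <= _ * X]ger0_norm ?subr_ge0//.
  apply: (@der_bound _ (fun u => f u - u * f1 x)) => // v /andP[xv vy].
  by apply: near1; rewrite !ger0_norm ?subr_ge0// lerB.
rewrite [X in _ <= _ * X]distrC [X in _ <= _ * X]ger0_norm ?subr_ge0//.
rewrite distrC.
apply: (@der_bound _ (fun u => f u - u * f1 x)) => // v /andP[yv vx].
by apply: near1; rewrite ![ `|_ - x|]distrC !ger0_norm ?subr_ge0// lerB.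
Qed.

(** The second order remainder in the parameter is bounded uniformly in [s], so it
survives integration over [s] in [0, 1]. *)
Lemma leibniz (f f1 f2 P : R -> R -> R) (Q : R -> R) (x K : R) :
  (forall s u, is_derive u (1 : R) (f ^~ s) (f1 u s)) ->
  (forall s u, is_derive u (1 : R) (f1 ^~ s) (f2 u s)) ->
  (forall s u, 0 <= s <= 1 -> `|u - x| <= 1 -> `|f2 u s| <= K) ->
  (forall u, primitive_of (f u) (P u)) -> primitive_of (f1 x) Q ->
  is_derive x (1 : R) (fun u => P u 1 - P u 0) (Q 1 - Q 0).
Proof.
move=> df df1 f2K dP dQ; apply: (@der_quadratic _ _ _ K) => y yx.
pose H s := P y s - P x s - (y - x) * Q s.
rewrite (_ : P y 1 - _ - _ - _ = H 1 - H 0); last by rewrite /H; ring.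
rewrite -[leRHS]mulr1 -[X in _ <= _ * X](subr0 1).
apply: (@der_bound _ H (fun s => f y s - f x s - (y - x) * f1 x s)) => // s s01.
  have ? := dP y s; have ? := dP x s; have ? := dQ s.
  by rewrite /H; der_tac; ring.
apply: (@taylor2 (f ^~ s) (f1 ^~ s) (f2 ^~ s)) => // u ux.
by apply: f2K => //; exact: le_trans yx.
Qed.
End Leibniz.

(** * Fresnel integrals *)

Section Fresnel.
Variable R : realType.
Implicit Types (F : R -> R).

Lemma continuous_of_der (f f' : R -> R) :
  (forall x, is_derive x (1 : R) f (f' x)) -> continuous f.
Proof. by move=> df x; exact: der_cont (df x). Qed.

Lemma primitive_of_der (f f' : R -> R) :
  (forall x, is_derive x (1 : R) f (f' x)) -> exists F, primitive_of f F.
Proof. by move/continuous_of_der/primitive_exists. Qed.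

Lemma primitive0_of_der (f f' : R -> R) :
  (forall x, is_derive x (1 : R) f (f' x)) ->
  exists F, primitive_of f F /\ F 0 = 0.
Proof.
move=> /primitive_of_der[F dF]; exists (fun x => F x - F 0).
split; last exact: subrr.
by move=> x; have ? := dF x; der_tac; ring.
Qed.

(** The integral of [osc al u] over [0, 1] is the imaginary part of
[e^(i al) int_0^1 e^(i u^2 (1 + s^2)) / (1 + s^2) ds], the auxiliary function
that accompanies the square of a Fresnel integral. *)
Definition osc (al u s : R) := sin (u ^+ 2 * oneDsqr s + al) / oneDsqr s.

Variables C S : R -> R.
Hypothesis dC : primitive_of (fun t => cos (t ^+ 2)) C.
Hypothesis dS : primitive_of (fun t => sin (t ^+ 2)) S.
Hypotheses (C0 : C 0 = 0) (S0 : S 0 = 0).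

Let oneDsqr_pos (s : R) : 0 < oneDsqr s. Proof. by rewrite /oneDsqr ltr_pwDl// sqr_ge0. Qed.
Let oneDsqr_nz (s : R) : oneDsqr s != 0. Proof. exact: lt0r_neq0. Qed.
Let dw s : is_derive s (1 : R) (@oneDsqr R) (2 * s).
Proof. by rewrite /oneDsqr; der_tac; ring. Qed.
Let f1 (al u s : R) := 2 * u * cos (u ^+ 2 * oneDsqr s + al).
Let f2 (al u s : R) :=
  2 * cos (u ^+ 2 * oneDsqr s + al) - 4 * u ^+ 2 * oneDsqr s * sin (u ^+ 2 * oneDsqr s + al).

Let dosc al s u : is_derive u (1 : R) ((osc al) ^~ s) (f1 al u s).
Proof. by rewrite /osc /f1; der_tac; field; exact: oneDsqr_nz. Qed.

Let df1 al s u : is_derive u (1 : R) ((f1 al) ^~ s) (f2 al u s).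
Proof. by rewrite /f1 /f2; der_tac; ring. Qed.

(** With [Z u := int_0^u e^(i t^2) dt = C u + i S u], the derivative of [Z^2] is
[2 e^(i u^2) Z u], that is, after the substitution [t = u s],
[int_0^1 2 u e^(i u^2 (1 + s^2)) ds].  This is also the derivative of
[- i int_0^1 e^(i u^2 (1 + s^2)) / (1 + s^2) ds], and the difference of the two
functions is determined at [u = 0], where [int_0^1 ds / (1 + s^2) = pi / 4].
The angle [al] selects the real linear combination: [al = 0] gives
[C^2 - S^2] and [al = pi / 2] gives [2 C S]. *)
Lemma fresnel_identity (al : R) (P : R -> R -> R) (x : R) :
  (forall u, primitive_of (osc al u) (P u)) ->
  P x 1 - P x 0 = sin al * (pi / 4) +
    (cos al * (C x ^+ 2 - S x ^+ 2) - 2 * sin al * (C x * S x)).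
Proof.
move=> dP.
pose G u := P u 1 - P u 0 -
  (cos al * (C u ^+ 2 - S u ^+ 2) - 2 * sin al * (C u * S u)).
have dG u : is_derive u (1 : R) G 0.
  (* the integral over s of the derivative in u, with s the upper bound *)
  pose Q s := 2 * (cos (u ^+ 2 + al) * C (u * s) - sin (u ^+ 2 + al) * S (u * s)).
  have dQ : primitive_of (f1 al u) Q.
    move=> s; have dCu : is_derive s (1 : R) (fun s => C (u * s)) (u * cos ((u * s) ^+ 2)).
      apply: der_comp; last exact: dC.
      by der_tac; ring.
    have dSu : is_derive s (1 : R) (fun s => S (u * s)) (u * sin ((u * s) ^+ 2)).
      apply: der_comp; last exact: dS.
      by der_tac; ring.
    rewrite /Q; der_tac.
    rewrite /f1 /oneDsqr.
    have -> : u ^+ 2 * (1 + s ^+ 2) + al = (u ^+ 2 + al) + (u * s) ^+ 2 by ring.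
    by rewrite (cosD (u ^+ 2 + al)); ring.
  have dU : is_derive u (1 : R) (fun v => P v 1 - P v 0) (Q 1 - Q 0).
    apply: (@leibniz _ (osc al) (f1 al) (f2 al) P Q u (2 + 8 * (`|u| + 1) ^+ 2)) => //.
    move=> s v s01 vu; rewrite /f2.
    have vv : v ^+ 2 <= (`|u| + 1) ^+ 2.
      rewrite -real_normK ?num_real// lerXn2r ?nnegrE ?addr_ge0//.
      by have := ler_normD (v - u) u; rewrite subrK; lra.
    have ws : oneDsqr s <= 2 by rewrite /oneDsqr; nra.
    have ? := oneDsqr_pos s; have ? := sqr_ge0 v.
    have h1 := cos_max (v ^+ 2 * oneDsqr s + al).
    have h2 := sin_max (v ^+ 2 * oneDsqr s + al).
    apply: le_trans (ler_normB _ _) _; apply: lerD.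
      by rewrite normrM ger0_norm//; lra.
    have p0 : 0 <= 4 * v ^+ 2 * oneDsqr s by nra.
    rewrite normrM ger0_norm//.
    apply: le_trans (_ : 4 * v ^+ 2 * oneDsqr s * 1 <= _).
      by rewrite ler_wpM2l.
    nra.
  have ? := dC u; have ? := dS u.
  rewrite /G; der_tac.
  rewrite /Q !mulr1 mulr0 C0 S0 cosD sinD; ring.
have G0 : G 0 = sin al * (pi / 4).
  rewrite /G C0 S0.
  have -> : P 0 1 - P 0 0 = sin al * atan 1 - sin al * atan 0.
    pose H (s : R) := P 0 s - sin al * atan s.
    have : H 0 = H 1.
      apply: (@der0_eq _ H (-1)) => [||s _]; [lra|lra|].
      have ? := dP 0 s; have ? := is_derive1_atan s.
      rewrite /H; der_tac.
      by rewrite /osc /oneDsqr expr0n/= mul0r add0r; ring.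
    by rewrite /H; lra.
  by rewrite atan1 atan0; ring.
have : G x = G 0.
  apply: (@der0_eq _ G (- `|x| - 1)) => //.
    by have := lerNnormlW (lexx `|x|); lra.
by rewrite G0 /G; lra.
Qed.

(** The interval [0, 1 / x] contributes at most its length.  On [1 / x, 1] the
phase has derivative [2 x^2 s], and an integration by parts leaves amplitudes
[1 / (x^2 s)] and [1 / (x^2 s^2)], whose contributions are of order [1 / x]. *)
Lemma oscillation_decay (al : R) (P : R -> R) (x : R) : 1 <= x ->
  primitive_of (osc al x) P -> `|P 1 - P 0| <= 4 / x.
Proof.
move=> x1 dP; have x0 : 0 < x by lra.
have xV1 : x^-1 <= 1 by rewrite invf_le1.
have xV0 : 0 < x^-1 by rewrite invr_gt0.
have X0 : 0 <= (2 * x ^+ 2)^-1 by rewrite invr_ge0 mulr_ge0// sqr_ge0.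
have near0 : `|P x^-1 - P 0| <= x^-1.
  rewrite -[leRHS]mul1r -[X in _ <= _ * X]subr0.
  apply: (@der_bound _ P (osc al x)) => [|s _|s _]; [lra|exact: dP|].
  rewrite /osc normrM -[leRHS]mulr1 ler_pM//; first exact: sin_max.
  by rewrite gtr0_norm ?invr_gt0// invf_le1// /w lerDl sqr_ge0.
pose m (s : R) := (s * oneDsqr s)^-1.
pose m' (s : R) := - (s * oneDsqr s) ^- 2 * (1 + 3 * s ^+ 2).
pose H (s : R) := P s + (2 * x ^+ 2)^-1 * (m s * cos (x ^+ 2 * oneDsqr s + al)).
pose H' (s : R) := (2 * x ^+ 2)^-1 * (m' s * cos (x ^+ 2 * oneDsqr s + al)).
have dH s : x^-1 <= s <= 1 -> is_derive s (1 : R) H (H' s).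
  move=> /andP[xs s1]; have s0 : 0 < s by lra.
  have sw0 : s * oneDsqr s != 0 by rewrite mulf_neq0 ?oneDsqr_nz// lt0r_neq0.
  have dm : is_derive s (1 : R) m (m' s).
    rewrite /m /m'; eapply der_eq.
      exact: (der_inv (f := fun s => s * oneDsqr s) sw0 (der_mul (der_id s) (dw s))).
    by cbv beta; rewrite /oneDsqr; ring.
  have ? := dP s; have ? := dw s.
  rewrite /H; der_tac; rewrite /H' /osc /m; field.
  by rewrite oneDsqr_nz !lt0r_neq0.
have dinv s : x^-1 <= s <= 1 ->
    is_derive s (1 : R) (fun s => - ((2 * x ^+ 2)^-1 * 3) * s^-1)
      ((2 * x ^+ 2)^-1 * (3 * s ^- 2)).
  move=> /andP[xs s1]; have s0 : s != 0 by apply: lt0r_neq0; lra.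
  eapply der_eq.
    exact: (der_mul (der_cst _ s) (der_inv (f := fun s => s) s0 (der_id s))).
  by cbv beta; field; rewrite s0 lt0r_neq0.
have HH : `|H 1 - H x^-1| <= 3 / 2 * x^-1.
  apply: le_trans (der_dom _ dH dinv _) _ => //.
    move=> s /andP[xs s1]; have s0 : 0 < s by lra.
    rewrite /H' normrM (ger0_norm X0).
    rewrite ler_wpM2l//.
    rewrite normrM -[leRHS]mulr1 ler_pM//; last exact: cos_max.
    have -> : m' s = - ((1 + 3 * s ^+ 2) / oneDsqr s ^+ 2 / s ^+ 2).
      by rewrite /m'; field; rewrite oneDsqr_nz lt0r_neq0.
    have q0 : 0 <= (1 + 3 * s ^+ 2) / oneDsqr s ^+ 2.
      by rewrite divr_ge0// ?sqr_ge0//; nra.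
    rewrite normrN ger0_norm; last by rewrite divr_ge0// sqr_ge0.
    rewrite ler_wpM2r ?invr_ge0 ?sqr_ge0// ler_pdivrMr ?exprn_gt0//.
    by rewrite /oneDsqr; nra.
  rewrite invr1 mulr1 invrK.
  rewrite (_ : - _ * x = - (3 / 2 * x^-1)); last by field; rewrite lt0r_neq0.
  lra.
have mb s : x^-1 <= s <= 1 ->
    `|(2 * x ^+ 2)^-1 * (m s * cos (x ^+ 2 * oneDsqr s + al))| <= x^-1 / 2.
  move=> /andP[xs s1]; have s0 : 0 < s by lra.
  have -> : x^-1 / 2 = (2 * x ^+ 2)^-1 * (x * 1) by field; rewrite lt0r_neq0.
  rewrite normrM (ger0_norm X0).
  rewrite ler_wpM2l//.
  rewrite normrM ler_pM//; last exact: cos_max.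
  rewrite /m gtr0_norm ?invr_gt0 ?mulr_gt0//.
  rewrite invf_ple ?posrE ?mulr_gt0//; apply: le_trans xs _.
  by apply: ler_peMr; [exact: ltW|rewrite /oneDsqr lerDl sqr_ge0].
have b1 := mb 1; have b2 := mb x^-1.
move: b1 b2; rewrite !lexx xV1 => /(_ isT) b1 /(_ isT) b2.
have -> : P 1 - P 0 = (P x^-1 - P 0) + ((H 1 - H x^-1) +
   ((2 * x ^+ 2)^-1 * (m x^-1 * cos (x ^+ 2 * oneDsqr x^-1 + al))
    - (2 * x ^+ 2)^-1 * (m 1 * cos (x ^+ 2 * oneDsqr 1 + al)))).
  by rewrite /H; ring.
apply: le_trans (ler_normD _ _) _.
set u1 := _ * (m x^-1 * _) in b2 *; set u2 := _ * (m 1 * _) in b1 *.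
have := ler_normD (H 1 - H x^-1) (u1 - u2).
have := ler_normB u1 u2.
lra.
Qed.
End Fresnel.

Section FresnelLimit.
Variable R : realType.

(** From [C^2 - S^2 -> 0] and [2 C S -> pi / 4] follow [(C + S)^2 -> pi / 2] and
[C - S -> 0].  Hence [C + S] has no zero beyond [16], keeps its sign there by
the intermediate value theorem, and converges to a square root of [pi / 2]. *)
Lemma fresnel_limit : exists (C S : R -> R) (c M : R),
  [/\ primitive_of (fun t => cos (t ^+ 2)) C,
      primitive_of (fun t => sin (t ^+ 2)) S, C 0 = 0, S 0 = 0 &
      c != 0 /\ forall x, 16 <= x -> `|C x - c| <= M / x /\ `|S x - c| <= M / x].
Proof.
have [C [dC C0]] : exists F, primitive_of (fun t : R => cos (t ^+ 2)) F /\ F 0 = 0.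
  apply: (@primitive0_of_der _ _ (fun t => - (2 * t) * sin (t ^+ 2))) => t.
  by der_tac; ring.
have [S [dS S0]] : exists F, primitive_of (fun t : R => sin (t ^+ 2)) F /\ F 0 = 0.
  apply: (@primitive0_of_der _ _ (fun t => 2 * t * cos (t ^+ 2))) => t.
  by der_tac; ring.
have key al x : 1 <= x ->
  `|sin al * (pi / 4)
    + (cos al * (C x ^+ 2 - S x ^+ 2) - 2 * sin al * (C x * S x))| <= 4 / x.
  move=> x1.
  have exP u : exists F, primitive_of (osc al u) F.
    rewrite /osc.
    apply: (@primitive_of_der _ _ (fun s => 2 * s * (u ^+ 2 * cos (u ^+ 2 * oneDsqr s + al)
       / oneDsqr s - sin (u ^+ 2 * oneDsqr s + al) / oneDsqr s ^+ 2))) => s.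
    have w0 : oneDsqr s != 0 by apply: lt0r_neq0; rewrite /oneDsqr ltr_pwDl// sqr_ge0.
    have ds : is_derive s (1 : R) (@oneDsqr R) (2 * s) by rewrite /oneDsqr; der_tac; ring.
    have ? := der_inv w0 ds.
    by der_tac; field.
  have [P dP] := choice exP.
  by rewrite -(fresnel_identity dC dS C0 S0 x dP); exact: oscillation_decay (dP x).
have keyD x : 1 <= x -> `|C x ^+ 2 - S x ^+ 2| <= 4 / x.
  by move/(key 0); rewrite sin0 cos0 mul0r mulr0 mul0r subr0 add0r mul1r.
have keyE x : 1 <= x -> `|pi / 4 - 2 * (C x * S x)| <= 4 / x.
  by move/(key (pi / 2)); rewrite sin_pihalf cos_pihalf mul1r mulr1 mul0r sub0r.
pose A x := C x + S x.
(* with d = C - S: A^2 = d^2 + 4 C S and d A = C^2 - S^2, so that A is bounded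
   below as soon as 2 C S is, and then d is small *)
have far x : 16 <= x ->
    [/\ `|C x - S x| <= 6 / x, `|A x ^+ 2 - pi / 2| <= 10 / x & 0 < A x ^+ 2].
  move=> x16; have x1 : 1 <= x by lra.
  have := keyD x x1; have := keyE x x1; have p2 := pi_ge2 R.
  have y0 : 0 < x^-1 by rewrite invr_gt0; lra.
  have y16 : 16 * x^-1 <= 1 by rewrite -ler_pdivlMr ?invr_gt0; [rewrite invrK mul1r|lra].
  rewrite (_ : C x ^+ 2 - S x ^+ 2 = (C x - S x) * A x); last by rewrite /A; ring.
  have EA : A x ^+ 2 = (C x - S x) ^+ 2 + 2 * (2 * (C x * S x)) by rewrite /A; ring.
  set E := 2 * (C x * S x) in EA *; set d := C x - S x in EA *.
  rewrite ler_distlC => /andP[E1 E2] dA.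
  have A2 : 1 / 2 <= A x ^+ 2 by rewrite EA; have := sqr_ge0 d; lra.
  have dA2 : d ^+ 2 * A x ^+ 2 <= 16 * x^-1 ^+ 2.
    rewrite -exprMn -[leLHS]real_normK ?num_real//.
    rewrite (_ : 16 * _ = (4 / x) ^+ 2); last by rewrite exprMn; congr (_ * _); ring.
    by rewrite lerXn2r// nnegrE mulr_ge0// ltW.
  have d2 : d ^+ 2 <= 32 * x^-1 ^+ 2 by have := sqr_ge0 d; nra.
  split.
  - have z0 : 0 <= 6 / x by rewrite mulr_ge0// ltW.
    rewrite -ler_sqr ?nnegrE// real_normK ?num_real//.
    by rewrite exprMn; have := sqr_ge0 x^-1; nra.
  - by rewrite EA ler_norml; have := sqr_ge0 d; nra.
  - lra.
have An0 x : 16 <= x -> A x != 0.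
  by move=> /far[_ _]; apply: contraTneq => ->; rewrite expr0n ltxx.
have cA : continuous A.
  by move=> x; apply: cvgD; [exact: der_cont (dC x)|exact: der_cont (dS x)].
pose sg := Num.sg (A 16).
have sgE : sg ^+ 2 = 1 by rewrite sqr_sg An0.
have sA x : 16 <= x -> 0 < sg * A x.
  move=> x16; rewrite ltNge; apply/negP => sAx.
  have sA16 : 0 < sg * A 16 by rewrite /sg -normrEsg normr_gt0 An0.
  have [||c c16] := @IVT R (fun y => sg * A y) 16 x 0 x16.
  - apply: continuous_subspaceT => y.
    by apply: cvgMl_tmp; exact: cA.
  - by rewrite ge_min le_max sAx (ltW sA16) orbT.
  move/eqP; rewrite mulf_eq0 (negPf (An0 c _)) ?(itvP c16)// orbF => /eqP sg0.
  by move: sA16; rewrite sg0 mul0r ltxx.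
have p2 := pi_ge2 R.
pose L := Num.sqrt (pi / 2 : R).
have L2 : L ^+ 2 = pi / 2 by rewrite sqr_sqrtr//; lra.
have L1 : 1 <= L by rewrite -[leLHS]sqrtr1 ler_wsqrtr//; lra.
exists C, S, (sg * L / 2), 10; split => //; split.
  rewrite !mulf_neq0// ?invr_neq0//; last by apply: lt0r_neq0; lra.
  by apply: contra_eq_neq sgE => ->; rewrite expr0n/= eq_sym oner_eq0.
move=> x x16; have [dx Ax _] := far x x16; have sAx := sA x x16.
have y0 : 0 < x^-1 by rewrite invr_gt0; lra.
have sAL : `|sg * A x - L| <= 10 / x.
  apply: le_trans Ax; rewrite -L2 -[A x ^+ 2]mul1r -sgE -exprMn subr_sqr normrM.
  by rewrite ler_peMr// ger0_norm; lra.
have AL : `|A x - sg * L| <= 10 / x.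
  have -> : A x - sg * L = sg * (sg * A x - L) by rewrite mulrBr mulrA -expr2 sgE mul1r.
  have sg1 : `|sg| = 1 by rewrite normr_sg An0.
  by rewrite normrM sg1 mul1r.
move: dx AL; rewrite /A !ler_norml; lra.
Qed.
End FresnelLimit.

(** * Asymptotics of Bessel functions of even order *)

Section Bessel.
Variable R : realType.

(** The integral over [0, pi] is [pi * J_2k z]. *)
Definition bessel_integrand (k : nat) (z p : R) : R :=
  cos (z * sin p) * cos (2 * k%:R * p).

Lemma der_bessel_integrand (k : nat) (z p : R) :
  is_derive p (1 : R) (bessel_integrand k z)
    (- (z * cos p * sin (z * sin p)) * cos (2 * k%:R * p)
     - 2 * k%:R * (cos (z * sin p) * sin (2 * k%:R * p))).
Proof. by rewrite /bessel_integrand; der_tac; ring. Qed.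

Lemma bessel_primitive (k : nat) (z : R) :
  exists F, primitive_of (bessel_integrand k z) F.
Proof. exact: primitive_of_der (der_bessel_integrand k z). Qed.

(** This is [J_2k + J_(2k+2) = (2 (2k+1) / z) J_(2k+1)]: the sum of the two
cosines contains the factor [cos p], which turns the integrand into the
derivative of [sin (z sin p) / z] times a cosine. *)
Lemma bessel_recurrence (k : nat) (z : R) (F G : R -> R) : 0 < z ->
  primitive_of (bessel_integrand k z) F ->
  primitive_of (bessel_integrand k.+1 z) G ->
  `|(F pi - F 0) + (G pi - G 0)| <= 8 * (2 * k%:R + 1) / z.
Proof.
move=> z0 dF dG; set n : R := 2 * k%:R + 1.
have n0 : 0 <= n by rewrite /n addr_ge0// mulr_ge0.
pose H p := F p + G p - 2 / z * (sin (z * sin p) * cos (n * p)).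
pose H' p := 2 * n / z * (sin (z * sin p) * sin (n * p)).
have -> : F pi - F 0 + (G pi - G 0) = H pi - H 0.
  by rewrite /H sinpi sin0 !mulr0 sin0 !mul0r; ring.
have dH p : is_derive p (1 : R) H (H' p).
  have ? := dF p; have ? := dG p.
  rewrite /H; der_tac.
  rewrite /bessel_integrand /H'.
  have -> : 2 * k%:R * p = n * p - p by rewrite /n; ring.
  have -> : 2 * k.+1%:R * p = n * p + p by rewrite /n -natr1; ring.
  rewrite cosB cosD; field; exact: lt0r_neq0.
have p4 : pi <= 4 :> R by have := pihalf_lt2 R; lra.
have p0 := pi_ge0 R.
apply: le_trans (@der_bound _ H H' 0 pi (2 * n / z) _ _ _) _ => //.
  move=> p _; rewrite /H' normrM ger0_norm ?divr_ge0 ?mulr_ge0 ?(ltW z0)//.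
  rewrite ler_piMr ?divr_ge0 ?mulr_ge0 ?(ltW z0)//.
  by rewrite normrM -[leRHS]mulr1 ler_pM ?sin_max.
rewrite subr0 mulrAC ler_wpM2r ?invr_ge0 ?(ltW z0)//.
have : 0 <= n * (4 - pi) by rewrite mulr_ge0// subr_ge0.
by lra.
Qed.

Lemma cos_piquarter (t : R) : - (pi / 4) <= t <= pi / 4 ->
  0 < cos t /\ 1 / 2 <= cos t ^+ 2.
Proof.
move=> /andP[t1 t2]; have p0 := pi_gt0 R.
split; first by apply: cos_gt0_pihalf; lra.
have : 0 <= cos (t *+ 2) by apply: cos_ge0_pihalf; rewrite (mulr2n t); lra.
by rewrite cos_mulr2n (mulr2n (cos t ^+ 2)); lra.
Qed.

Lemma primitive_odd (f F : R -> R) : (forall t, f (- t) = f t) ->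
  primitive_of f F -> F 0 = 0 -> forall x, F (- x) = - F x.
Proof.
move=> fN dF F0 x.
have : F x + F (- x) = F 0 + F (- 0).
  apply: (@der0_eq _ (fun y => F y + F (- y)) (- `|x| - 1)) => [||y _].
  - by have := lerNnormlW (lexx `|x|); lra.
  - by have := normr_ge0 x; lra.
  eapply der_eq.
    apply: der_add; first exact: dF.
    exact: (der_comp (der_opp (der_id y)) (dF (- y))).
  by cbv beta; rewrite fN; ring.
by rewrite oppr0 F0; lra.
Qed.

(** The phase [z sin p] is stationary at [p = pi / 2].  With [p = pi / 2 + 2 t] it
becomes [z - 2 z (sin t)^2], and replacing [dt] by [cos t dt] gives exact
Fresnel integrals in the variable [sqrt (2 z) * sin t].  The weight of the
difference, [1 - cos t], vanishes at the stationary point, so an integration by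
parts bounds that difference by [O (1 / z)]. *)
Lemma bessel0_asymptotics : exists c M : R, [/\ c != 0, 8 <= M &
  forall z F, 256 <= z -> primitive_of (bessel_integrand 0 z) F ->
  `|(F pi - F 0) - c * (cos z + sin z) / Num.sqrt z| <= M / z].
Proof.
have [C [S [c [M [dC dS C0 S0 [c0 lim]]]]]] := fresnel_limit R.
have r2 : 0 < Num.sqrt 2 :> R by rewrite sqrtr_gt0.
have r22 : Num.sqrt 2 ^+ 2 = 2 :> R by rewrite sqr_sqrtr.
have r21 : 1 <= Num.sqrt 2 :> R by rewrite -[leLHS]sqrtr1 ler_wsqrtr//; lra.
exists (4 / Num.sqrt 2 * c), (22 + 8 * `|M|); split.
- by rewrite mulf_neq0// mulf_neq0// ?invr_neq0 ?lt0r_neq0.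
- by have := normr_ge0 M; lra.
move=> z F z256 dF; have z0 : 0 < z by lra.
set rz := Num.sqrt z; set rt := Num.sqrt 2 in r2 r22 r21 *.
have rz0 : 0 < rz by rewrite sqrtr_gt0.
have rz2 : rz ^+ 2 = z by rewrite sqr_sqrtr// ltW.
have rz16 : 16 <= rz.
  by rewrite -ler_sqr ?nnegrE ?(ltW rz0)// rz2; apply: le_trans z256; lra.
pose la := rt * rz.
have la0 : 0 < la by rewrite mulr_gt0.
have la2 : la ^+ 2 = 2 * z by rewrite exprMn r22 rz2.
have p0 := pi_gt0 R.
have p4 : pi <= 4 :> R by have := pihalf_lt2 R; lra.
have sinq : la * sin (pi / 4) = rz.
  have s0 : 0 < sin (pi / 4) :> R by apply: sin_gt0_pihalf; lra.
  apply/eqP; rewrite -(@eqrXn2 _ 2) ?mulr_ge0 ?(ltW la0) ?(ltW s0) ?(ltW rz0) ?(ltW r2)//.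
  rewrite exprMn la2 rz2 sin2cos2.
  have := cos_mulr2n (pi / 4 : R).
  rewrite (_ : pi / 4 *+ 2 = pi / 2); last by rewrite mulr2n; field.
  rewrite cos_pihalf mulr2n => E; apply/eqP.
  have -> : cos (pi / 4) ^+ 2 = 1 / 2 :> R by lra.
  by field.
pose y (t : R) := z - 2 * z * sin t ^+ 2.
pose q (t : R) := (1 + cos t) * cos t.
(* m t * sin t * cos t = 1 - cos t *)
pose m t := sin t / q t.
pose m' t := (cos t * q t + sin t ^+ 2 * (1 + 2 * cos t)) / q t ^+ 2.
pose H t := 2 / la * (cos z * C (la * sin t) + sin z * S (la * sin t)).
pose K t := F (pi / 2 + 2 * t) - H t + (2 * z)^-1 * (m t * sin (y t)).
pose K' t := (2 * z)^-1 * (m' t * sin (y t)).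
have q_ge t : - (pi / 4) <= t <= pi / 4 -> 1 / 2 <= q t.
  by move=> /cos_piquarter[c1 c2]; rewrite /q; nra.
have dK t : - (pi / 4) <= t <= pi / 4 -> is_derive t (1 : R) K (K' t).
  move=> tI; have [ct ct2] := cos_piquarter tI; have qt := q_ge t tI.
  have qt0 : q t != 0 by apply: lt0r_neq0; lra.
  have dFt : is_derive t (1 : R) (fun t => F (pi / 2 + 2 * t)) (2 * cos (y t)).
    eapply der_eq.
      apply: (@der_comp _ F (fun t => pi / 2 + 2 * t) t 2); last exact: dF.
      by der_tac; ring.
    rewrite /bessel_integrand mulr0 mul0r cos0 mulr1 addrC sinDpihalf.
    rewrite (mulr_natl t 2) cos_mulr2n cos2sin2 /y (mulr2n (1 - _)).
    by congr (2 * cos _); ring.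
  have dy : is_derive t (1 : R) y (- 4 * z * sin t * cos t).
    by rewrite /y; der_tac; ring.
  have dq : is_derive t (1 : R) q (- sin t * (1 + 2 * cos t)).
    by rewrite /q; der_tac; ring.
  have dqV := der_inv qt0 dq.
  have dm : is_derive t (1 : R) m (m' t).
    by rewrite /m; der_tac; rewrite /m'; field.
  have dls : is_derive t (1 : R) (fun t => la * sin t) (la * cos t).
    by der_tac; ring.
  have yE : y t = z - (la * sin t) ^+ 2 by rewrite /y exprMn la2.
  have dH : is_derive t (1 : R) H (2 * cos t * cos (y t)).
    have ? := der_comp dls (dC _); have ? := der_comp dls (dS _).
    rewrite /H; der_tac; rewrite yE cosB; field; exact: lt0r_neq0.
  rewrite /K; der_tac; rewrite /K'.
  have mE : m t * (sin t * cos t) = 1 - cos t.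
    have -> : m t * (sin t * cos t) = sin t ^+ 2 * cos t / q t by rewrite /m; field.
    by rewrite sin2cos2 /q; field; rewrite !lt0r_neq0//; lra.
  rewrite (_ : 2 * cos t = 2 - 2 * (m t * (sin t * cos t))); last by rewrite mE; ring.
  by field; rewrite lt0r_neq0.
have E1 : F pi - F 0 = F (pi / 2 + 2 * (pi / 4)) - F (pi / 2 + 2 * (- (pi / 4))).
  by congr (F _ - F _); field.
have Codd : C (- rz) = - C rz.
  by apply: primitive_odd dC C0 _ => t; rewrite sqrrN.
have Sodd : S (- rz) = - S rz.
  by apply: primitive_odd dS S0 _ => t; rewrite sqrrN.
(* since sin (pi / 4) * sqrt (2 z) = sqrt z *)
have HE : H (pi / 4) - H (- (pi / 4)) = 4 / rt * (cos z * C rz + sin z * S rz) / rz.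
  rewrite /H sinN mulrN sinq Codd Sodd /la; field.
  by rewrite !lt0r_neq0.
have qI : - (pi / 4) <= (pi : R) / 4 <= pi / 4 by lra.
have qI2 : - (pi / 4) <= - ((pi : R) / 4) <= pi / 4 by lra.
have z20 : 0 < (2 * z)^-1 by rewrite invr_gt0 mulr_gt0.
have mb t : - (pi / 4) <= t <= pi / 4 -> `|(2 * z)^-1 * (m t * sin (y t))| <= 1 / z.
  move=> tI; have qt := q_ge t tI.
  rewrite normrM gtr0_norm// (_ : 1 / z = (2 * z)^-1 * (2 * 1)); last by field; rewrite lt0r_neq0.
  rewrite ler_wpM2l ?(ltW z20)// normrM ler_pM ?sin_max//.
  rewrite /m normrM normfV (gtr0_norm (_ : 0 < q t)); last lra.
  by rewrite ler_pdivrMr; [have := sin_max t; lra|lra].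
have Kb : `|K (pi / 4) - K (- (pi / 4))| <= (2 * z)^-1 * 20 * (pi / 4 - - (pi / 4)).
  apply: (der_bound _ dK) => [|t tI]; first lra.
  have qt := q_ge t tI; have [ct ct2] := cos_piquarter tI.
  rewrite /K' normrM gtr0_norm// ler_wpM2l ?(ltW z20)//.
  rewrite normrM -[leRHS]mulr1 ler_pM ?sin_max//.
  rewrite /m' normrM normfV (ger0_norm (sqr_ge0 _)) ler_pdivrMr; last by rewrite exprn_gt0; lra.
  have s2 : 0 <= sin t ^+ 2 <= 1 by rewrite sqr_ge0 sin2cos2; lra.
  have c1 := cos_le1 t.
  have q2 : 1 / 4 <= q t ^+ 2 by nra.
  have q3 : q t <= 2 by rewrite /q; nra.
  by rewrite ger0_norm; nra.
have z2E : (2 * z)^-1 = z^-1 / 2 by field; rewrite lt0r_neq0.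
have zV0 : 0 < z^-1 by rewrite invr_gt0.
have [Cl Sl] := lim rz rz16.
have H2 : `|4 / rt * (cos z * C rz + sin z * S rz) / rz
    - 4 / rt * c * (cos z + sin z) / rz| <= 8 * `|M| / z.
  have rzV : 0 < rz^-1 by rewrite invr_gt0.
  have MM : M / rz <= `|M| / rz by rewrite ler_wpM2r ?(ltW rzV)// ler_norm.
  have -> : 4 / rt * (cos z * C rz + sin z * S rz) / rz
      - 4 / rt * c * (cos z + sin z) / rz = 4 / rt / rz * (cos z * (C rz - c) + sin z * (S rz - c)) by ring.
  have -> : 8 * `|M| / z = 4 / rz * (2 * (`|M| / rz)).
    by rewrite -rz2; field; exact: lt0r_neq0.
  have rtV : rt^-1 <= 1 by rewrite invf_le1.
  have rtV0 : 0 < rt^-1 by rewrite invr_gt0.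
  rewrite normrM ger0_norm ?mulr_ge0 ?(ltW rzV) ?(ltW rtV0)//.
  rewrite ler_pM ?mulr_ge0 ?(ltW rzV) ?(ltW rtV0)//.
    by rewrite ler_wpM2r ?(ltW rzV)//; lra.
  apply: le_trans (ler_normD _ _) _; rewrite mulr_natl mulr2n; apply: lerD.
    rewrite normrM -[leRHS]mul1r ler_pM ?cos_max//; exact: le_trans Cl MM.
  rewrite normrM -[leRHS]mul1r ler_pM ?sin_max//; exact: le_trans Sl MM.
rewrite E1.
have K1 := mb _ qI; have K2 := mb _ qI2.
move: Kb HE K1 K2 H2; rewrite /K z2E.
set a1 := _ * (m (pi / 4) * _); set a2 := _ * (m (- (pi / 4)) * _).
set F1 := F _; set F2 := F _; set X := 4 / rt * _ / rz; set Y := 4 / rt * _ * _ / rz.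
set H1 := H _; set H2 := H _.
move=> Kb HE K1 K2 H3.
have p4z : z^-1 * pi <= 4 * z^-1 by rewrite mulrC ler_wpM2r// ltW.
move: Kb K1 K2 H3; rewrite !ler_norml.
set MM := `|M|.
move=> /andP[? ?] /andP[? ?] /andP[? ?] /andP[? ?].
lra.
Qed.

(** By the recurrence, [J_2k] changes sign with [k] up to [O (1 / z)]; summing the
errors up to [k] makes the constant grow quadratically. *)
Lemma bessel_asymptotics : exists c M : R, [/\ c != 0, 0 <= M &
  forall (k : nat) z F, 256 <= z -> primitive_of (bessel_integrand k z) F ->
  `|(F pi - F 0) - (-1) ^+ k * c * (cos z + sin z) / Num.sqrt z|
    <= M * (k%:R + 1) ^+ 2 / z].
Proof.
have [c [M [c0 M8 H0]]] := bessel0_asymptotics.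
exists c, M; split => //; first lra.
elim=> [|k IH] z F z256 dF.
  by rewrite expr0 mul1r add0r expr1n mulr1; exact: H0.
have [G dG] := bessel_primitive k z.
have z0 : 0 < z by lra.
have zV0 : 0 < z^-1 by rewrite invr_gt0.
have := IH z G z256 dG; have := bessel_recurrence z0 dG dF.
rewrite (exprS (-1) k) -(natr1 k) mulN1r !mulNr.
set Y := _ * c * _ / _; set K : R := k%:R.
have K0 : 0 <= K by rewrite ler0n.
have : 8 * (2 * K + 1) / z + M * (K + 1) ^+ 2 / z <= M * (K + 1 + 1) ^+ 2 / z.
  by rewrite -mulrDl ler_wpM2r ?(ltW zV0)//; nra.
rewrite !ler_norml => ? /andP[? ?] /andP[? ?].
lra.
Qed.
End Bessel.

(** * Negative eigenvalues from eigenvectors *)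

Section NegativeEigenvalues.

(** In a basis that extends the rows of [V] the matrix [A] is block triangular,
with [diag_mx d] as a diagonal block. *)
Lemma char_poly_dvdp_diag (F : fieldType) (K N : nat) (A : 'M[F]_N)
    (V : 'M[F]_(K, N)) (d : 'rV[F]_K) :
  row_free V -> V *m A = diag_mx d *m V ->
  \prod_(i < K) ('X - (d 0 i)%:P) %| char_poly A.
Proof.
move=> Vfree VA.
have [m NE] : exists m, N = (K + m)%N.
  by exists (N - K)%N; rewrite subnKC// -(eqP Vfree) rank_leq_col.
subst N.
have [W Wu] : exists W : 'M[F]_(m, K + m), col_mx V W \in unitmx.
  have rk : \rank (V^C)%MS = m by rewrite mxrank_compl (eqP Vfree) addKn.
  exists (castmx (rk, erefl) (row_base (V^C)%MS)).
  rewrite -row_full_unit -sub1mx -addsmxE.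
  rewrite (adds_eqmx (eqmx_refl _) (eqmx_trans (eqmx_cast _ _) (eq_row_base _))).
  by rewrite sub1mx addsmx_compl_full.
pose P := col_mx V W.
pose B := P *m A *m invmx P.
have BP : B *m P = P *m A by rewrite /B mulmxKV.
have uB : usubmx B = row_mx (diag_mx d) 0.
  apply: (row_free_inj (_ : row_free P)); first by rewrite row_free_unit.
  by rewrite /= mul_usub_mx BP mul_col_mx col_mxKu VA mul_row_col mul0mx addr0.
have BE : B = block_mx (diag_mx d) 0 (dlsubmx B) (drsubmx B).
  by rewrite -[LHS]submxK /ulsubmx /ursubmx uB row_mxKl row_mxKr.
have -> : char_poly A = char_poly B.
  pose Pp := map_mx polyC P; pose Pi := map_mx polyC (invmx P).
  have PPi : Pp *m Pi = 1%:M by rewrite -map_mxM mulmxV// map_mx1.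
  rewrite /char_poly.
  have -> : char_poly_mx B = Pp *m char_poly_mx A *m Pi.
    rewrite /char_poly_mx mulmxBr mulmxBl (scalar_mxC _ Pp) -(mulmxA _ Pp Pi) PPi mulmx1.
    by rewrite -!map_mxM.
  by rewrite !det_mulmx mulrAC -det_mulmx PPi det1 mul1r.
rewrite BE /char_poly /char_poly_mx map_block_mx map_mx0.
rewrite (scalar_mx_block _ _ 'X) opp_block_mx add_block_mx oppr0 addr0 det_lblock.
apply: dvdp_mulr.
rewrite (_ : \det _ = char_poly (diag_mx d)) // char_poly_trig ?diag_mx_is_trig//.
rewrite [X in _ %| X](eq_bigr (fun i => 'X - (d 0 i)%:P)) ?dvdpp// => i _.
by rewrite mxE eqxx mulr1n.
Qed.

(** Only divisibility of the characteristic polynomial is used, so repeated values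
in [d] are counted correctly without separating the eigenspaces. *)
Lemma num_neg_eigenvalues_ge (R : realType) (K N : nat) (A : 'M[R]_N)
    (V : 'M[R]_(K, N)) (d : 'rV[R]_K) :
  row_free V -> V *m A = diag_mx d *m V -> (forall i, d 0 i < 0) ->
  (K <= num_neg_eigenvalues A)%N.
Proof.
move=> Vfree VA dneg.
have := char_poly_dvdp_diag Vfree VA.
set p := char_poly A => dvd.
have p0 : p != 0 by rewrite monic_neq0// char_poly_monic.
pose ds := [seq d 0 i | i <- enum 'I_K].
have dsE : \prod_(i < K) ('X - (d 0 i)%:P) = \prod_(y <- ds) ('X - y%:P).
  by rewrite big_map big_enum.
have cm a : (count_mem a ds <= mup a p)%N.
  rewrite mup_geq// -mu_prod_XsubC -dsE; apply: dvdp_trans dvd.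
  by rewrite -mup_geq// dsE monic_neq0// monic_prod_XsubC.
rewrite /num_neg_eigenvalues -/p.
set D := [set a | _ /\ _].
have Dfin : finite_set D.
  apply: contrapT => /(@infinite_set_fset _ _ (size p))[B BD sB].
  suff : (size (enum_fset B) < size p)%N by rewrite ltnNge sB.
  apply: max_poly_roots => //; last exact: fset_uniq.
  by apply/allP => a aB; rewrite -eigenvalue_root_char; have [] := BD a aB.
rewrite fsbig_finite//.
have -> : K = (\sum_(a <- fset_set D) count_mem a ds)%N.
  transitivity (\sum_(b <- ds) 1)%N.
    by rewrite sum1_size size_map size_enum_ord.
  under [RHS]eq_bigr do rewrite -sum1_count big_mkcond.
  rewrite exchange_big/= big_seq [RHS]big_seq; apply: eq_bigr => b bds.
  rewrite -big_mkcond sum1_count.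
  rewrite (eq_count (a2 := pred1 b)); last by move=> a /=; rewrite eq_sym.
  rewrite count_uniq_mem ?fset_uniq//.
  rewrite in_fset_set// mem_set//; split.
    rewrite eigenvalue_root_char; rewrite -dvdp_XsubCl XsubC_dvd//.
    by apply: leq_trans (cm b); rewrite -has_count; apply/hasP; exists b => /=.
  by move/mapP: bds => [i _ ->].
by apply: leq_sum => a _.
Qed.
End NegativeEigenvalues.

(** * Regular polygons *)

Section Polygon.
Variables (R : realType) (n : nat).
Implicit Types (i j : 'I_n.+1) (F : R -> R).

(** Half of the central angle of the vertex [i]; chords are sines of differences of
half angles, so [pi] is the relevant period. *)
Definition node i : R := pi * i%:R / n.+1%:R.

Let n0 : n.+1%:R != 0 :> R. Proof. by rewrite pnatr_eq0. Qed.

Let n1 : 1 + n%:R != 0 :> R. Proof. by rewrite addrC natr1. Qed.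

Lemma periodic_natmul F (m : nat) : (forall t, F (t + pi) = F t) ->
  forall t, F (t + pi * m%:R) = F t.
Proof.
move=> FP; elim: m => [|m IH] t; first by rewrite mulr0 addr0.
by rewrite -natr1 mulrDr mulr1 addrA FP IH.
Qed.

Lemma node_modn F (m : nat) : (forall t, F (t + pi) = F t) ->
  F (pi * (m %% n.+1)%:R / n.+1%:R) = F (pi * m%:R / n.+1%:R).
Proof.
move=> FP; rewrite -(periodic_natmul (m %/ n.+1) FP); congr F.
by rewrite [in RHS](divn_eq m n.+1) natrD natrM; field; exact: n1.
Qed.

Lemma sum_node_shift F j : (forall t, F (t + pi) = F t) ->
  \sum_i F (node i) = \sum_i F (node i + node j).
Proof.
move=> FP; rewrite (reindex_inj (addIr j)); apply: eq_bigr => i _.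
rewrite /node /= node_modn// natrD; congr F; field.
exact: n1.
Qed.

Lemma sum_node_opp F : (forall t, F (t + pi) = F t) ->
  \sum_i F (node i) = \sum_i F (- node i).
Proof.
move=> FP; rewrite (reindex_inj oppr_inj); apply: eq_bigr => i _.
rewrite /node /= node_modn// natrB; last exact: ltnW.
rewrite -[RHS]FP; congr F; field.
exact: n1.
Qed.

Lemma sum_node_odd F : (forall t, F (t + pi) = F t) ->
  (forall t, F (- t) = - F t) -> \sum_i F (node i) = 0.
Proof.
move=> FP FN; have := sum_node_opp FP.
under [RHS]eq_bigr do rewrite FN.
by rewrite sumrN; lra.
Qed.

Lemma cos2k_periodic (k : nat) (t : R) : cos (2 * k%:R * (t + pi)) = cos (2 * k%:R * t).
Proof.
have := periodicn (@cosD2pi R) k (2 * k%:R * t) => <-.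
by congr cos; rewrite -mulr_natr (mulr2n pi); ring.
Qed.

Lemma sin2k_periodic (k : nat) (t : R) : sin (2 * k%:R * (t + pi)) = sin (2 * k%:R * t).
Proof.
have := periodicn (@sinD2pi R) k (2 * k%:R * t) => <-.
by congr sin; rewrite -mulr_natr (mulr2n pi); ring.
Qed.

(** Shifting the nodes by [node j] and expanding the cosine of a sum leaves the
cosine coefficient of [e] and its sine coefficient, which vanishes because [e]
is even. *)
Lemma circulant_eigen (e : R -> R) (k : nat) j :
  (forall t, e (t + pi) = e t) -> (forall t, e (- t) = e t) ->
  \sum_i cos (2 * k%:R * node i) * e (node i - node j) =
  (\sum_i cos (2 * k%:R * node i) * e (node i)) * cos (2 * k%:R * node j).
Proof.
move=> eP eN.
rewrite (sum_node_shift (F := fun t => cos (2 * k%:R * t) * e (t - node j)) j).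
  under eq_bigr do rewrite addrK mulrDr cosD mulrBl.
  rewrite sumrB -[RHS]subr0 mulr_suml; congr (_ - _).
    by apply: eq_bigr => i _; ring.
  have S0 : \sum_i sin (2 * k%:R * node i) * e (node i) = 0.
    apply: (sum_node_odd (F := fun t => sin (2 * k%:R * t) * e t)) => t.
      by rewrite sin2k_periodic eP.
    by rewrite mulrN sinN eN mulNr.
  transitivity ((\sum_i sin (2 * k%:R * node i) * e (node i)) * sin (2 * k%:R * node j));
    last by rewrite S0 mul0r.
  rewrite mulr_suml.
  by apply: eq_bigr => i _; ring.
by move=> t; rewrite cos2k_periodic -(eP (t - node j)); congr (_ * e _); ring.
Qed.

(** The constant kernel is circulant, so the sum is its own product with
[cos (2 k * node 1)], which is less than [1]. *)
Lemma sum_cos_node (k : nat) : (0 < k < n.+1)%N ->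
  \sum_i cos (2 * k%:R * node i) = 0.
Proof.
move=> /andP[k0 kn].
have nn : (1 < n.+1)%N by apply: leq_ltn_trans kn.
have := @circulant_eigen (fun=> 1) k (Ordinal nn) (fun=> erefl) (fun=> erefl).
under eq_bigr do rewrite mulr1.
set Z := \sum_i _.
pose x : R := k%:R * node (Ordinal nn).
have -> : 2 * k%:R * node (Ordinal nn) = x *+ 2 by rewrite /x mulr2n; ring.
have x0 : 0 < x by rewrite /x /node /= mulr1 mulr_gt0 ?ltr0n// divr_gt0// pi_gt0.
have xpi : x < pi.
  rewrite /x /node/= mulr1 mulrCA -[ltRHS]mulr1 ltr_pM2l ?pi_gt0//.
  by rewrite ltr_pdivrMr// mul1r ltr_nat.
have sx : 0 < sin x by apply: sin_gt0_pi; rewrite x0.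
rewrite cos_mulr2n cos2sin2 (mulr2n (1 - _)) => ZE.
have : Z * (2 * sin x ^+ 2) = 0 by lra.
by move/eqP; rewrite mulf_eq0 => /orP[/eqP//|/eqP]; nra.
Qed.

Lemma cos_orthogonal (a b : nat) : (0 < a)%N -> (0 < b)%N ->
  (2 * a < n.+1)%N -> (2 * b < n.+1)%N ->
  \sum_i cos (2 * a%:R * node i) * cos (2 * b%:R * node i) =
  (if a == b then n.+1%:R / 2 else 0).
Proof.
wlog ba : a b / (b <= a)%N => [H a0 b0 an bn|a0 b0 an bn].
  have [/H->//|/ltnW/H ba] := leqP b a.
  by rewrite eq_sym -ba//; apply: eq_bigr => i _; rewrite mulrC.
have E i : cos (2 * a%:R * node i) * cos (2 * b%:R * node i) =
    (cos (2 * (a - b)%:R * node i) + cos (2 * (a + b)%:R * node i)) / 2.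
  by rewrite natrB// natrD mulrBr mulrDr mulrBl mulrDl cosB cosD; field.
under eq_bigr do rewrite E.
rewrite -mulr_suml big_split/= (sum_cos_node (k := a + b)); last by lia.
rewrite addr0; case: eqVneq => [->|ab].
  rewrite subnn; under eq_bigr do rewrite mulr0 mul0r cos0.
  by rewrite sumr_const card_ord.
by rewrite sum_cos_node ?mul0r//; lia.
Qed.

Definition vertex (r : R) i : 'rV[R]_2 :=
  \row_(c < 2) (r * (if c == 0 then cos (2 * node i) else sin (2 * node i))).

Lemma vertex_dist (r : R) i j : 0 < r ->
  euclidean_norm (vertex r i - vertex r j) = 2 * r * `|sin (node i - node j)|.
Proof.
move=> r0; rewrite /euclidean_norm big_ord_recl big_ord1 !mxE/=.
set a := node i; set b := node j.
rewrite [X in Num.sqrt X](_ : _ = (2 * r * sin (a - b)) ^+ 2).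
  by rewrite sqrtr_sqr normrM gtr0_norm ?mulr_gt0.
have := cos2Dsin2 (2 * a); have := cos2Dsin2 (2 * b).
have : cos (2 * a - 2 * b) = 1 - 2 * sin (a - b) ^+ 2.
  by rewrite -mulrBr (mulr_natl (a - b) 2) cos_mulr2n cos2sin2 (mulr2n (1 - _)); ring.
rewrite cosB => E1 E2 E3.
set s := sin (a - b) in E1 *.
transitivity (r ^+ 2 * ((cos (2 * a) ^+ 2 + sin (2 * a) ^+ 2)
    + (cos (2 * b) ^+ 2 + sin (2 * b) ^+ 2)
    - 2 * (cos (2 * a) * cos (2 * b) + sin (2 * a) * sin (2 * b)))); first by ring.
by rewrite E1 E2 E3; ring.
Qed.

Lemma node_ge0 i : 0 <= node i.
Proof. by rewrite /node divr_ge0 ?mulr_ge0// pi_ge0. Qed.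

Lemma node_ltpi i : node i < pi.
Proof.
by rewrite /node ltr_pdivrMr ?ltr0n// ltr_pM2l ?pi_gt0// ltr_nat.
Qed.

Lemma sin_node_ge0 i : 0 <= sin (node i).
Proof. by rewrite sin_ge0_pi// node_ge0 ltW// node_ltpi. Qed.

Lemma vertex_inj (r : R) : 0 < r -> injective (vertex r).
Proof.
move=> r0 i j Exy.
have : euclidean_norm (vertex r i - vertex r j) = 0.
  rewrite Exy subrr /euclidean_norm big1 ?sqrtr0// => c _.
  by rewrite mxE expr0n.
rewrite vertex_dist// => /eqP; rewrite !mulf_eq0 pnatr_eq0 (gt_eqF r0)/= normr_eq0 => s0.
have node_inj : node i = node j -> i = j.
  move=> /(mulIf (invr_neq0 n0))/(mulfI (lt0r_neq0 (pi_gt0 R)))/eqP.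
  by rewrite eqr_nat => /eqP/val_inj.
have [ij|ij|/node_inj//] := ltgtP (node i) (node j).
- have : 0 < sin (node j - node i).
    by apply: sin_gt0_pi; have := node_ltpi j; have := node_ge0 i; lra.
  by rewrite -opprB sinN (eqP s0) oppr0 ltxx.
- have : 0 < sin (node i - node j).
    by apply: sin_gt0_pi; have := node_ltpi i; have := node_ge0 j; lra.
  by rewrite (eqP s0) ltxx.
Qed.

(** The cosine vectors of distinct frequencies below half the number of vertices
are orthogonal eigenvectors of the Schoenberg matrix. *)
Lemma polygon_negative (g : R -> R) (r : R) (K : nat) (ks : 'I_K -> nat) :
  0 < r -> injective ks -> (forall a, 0 < ks a)%N ->
  (forall a, 2 * ks a < n.+1)%N ->
  (forall a, \sum_i cos (2 * (ks a)%:R * node i) * g (2 * r * sin (node i)) < 0) ->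
  injective (vertex r) /\
  (K <= num_neg_eigenvalues (schoenberg_mx g (vertex r)))%N.
Proof.
move=> r0 ks_inj ks0 ksn neg; split; first exact: vertex_inj.
pose V : 'M[R]_(K, n.+1) := \matrix_(a, j) cos (2 * (ks a)%:R * node j).
pose d : 'rV[R]_K :=
  \row_a \sum_i cos (2 * (ks a)%:R * node i) * g (2 * r * sin (node i)).
apply: (@num_neg_eigenvalues_ge _ _ _ _ V d) => [||a]; last by rewrite mxE.
  apply/row_freeP; exists ((2 / n.+1%:R) *: V^T).
  apply/matrixP => a b; rewrite -scalemxAr !mxE.
  under eq_bigr do rewrite !mxE.
  rewrite cos_orthogonal// (inj_eq ks_inj).
  by case: eqVneq => _; [rewrite mulr1n; field; exact: n1|rewrite mulr0].
apply/matrixP => a j; rewrite mul_diag_mx !mxE.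
pose e (t : R) := g (2 * r * `|sin t|).
have eP t : e (t + pi) = e t by rewrite /e sinDpi normrN.
have eN t : e (- t) = e t by rewrite /e sinN normrN.
under eq_bigr do rewrite !mxE vertex_dist//.
rewrite (circulant_eigen (e := e))//; congr (_ * _).
by apply: eq_bigr => i _; rewrite /e ger0_norm// sin_node_ge0.
Qed.
End Polygon.

(** * Riemann sums *)

Section RiemannSums.
Variable R : realType.

Lemma riemann_sum (f f1 F : R -> R) (b L : R) (n : nat) : 0 <= b ->
  primitive_of f F -> (forall u, is_derive u (1 : R) f (f1 u)) ->
  (forall u, `|f1 u| <= L) ->
  `|b / n.+1%:R * (\sum_(i < n.+1) f (b * i%:R / n.+1%:R)) - (F b - F 0)|
    <= L * b ^+ 2 / n.+1%:R.
Proof.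
move=> b0 dF df f1L.
have N0 : 0 < n.+1%:R :> R by rewrite ltr0n.
set h := b / n.+1%:R; set x : nat -> R := fun i => b * i%:R / n.+1%:R.
have -> : F b - F 0 = \sum_(i < n.+1) (F (x i.+1) - F (x i)).
  rewrite -(big_mkord xpredT (fun i => F (x i.+1) - F (x i))) telescope_sumr//.
  by rewrite /x mulr0 mul0r mulfK// lt0r_neq0.
rewrite mulr_sumr -sumrB.
have -> : L * b ^+ 2 / n.+1%:R = \sum_(i < n.+1) (L * h ^+ 2).
  rewrite sumr_const card_ord -[RHS]mulr_natr /h; field.
  by rewrite addrC natr1 pnatr_eq0.
apply: le_trans (ler_norm_sum _ _ _) _; apply: ler_sum => i _.
have xh : x i.+1 - x i = h.
  rewrite /x /h -natr1; field.
  by rewrite addrC natr1 pnatr_eq0.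
rewrite distrC -xh; apply: taylor2 dF df _ => u _; exact: f1L.
Qed.

Lemma bessel_riemann (k : nat) (z : R) (F : R -> R) :
  primitive_of (bessel_integrand k z) F ->
  (pi / n.+1%:R * \sum_(i < n.+1) cos (2 * k%:R * node R i) * cos (z * sin (node R i)))
    @[n --> \oo] --> F pi - F 0.
Proof.
move=> dF; pose L : R := `|z| + 2 * k%:R.
have L0 : 0 <= L * pi ^+ 2 by rewrite mulr_ge0 ?sqr_ge0// addr_ge0// mulr_ge0.
apply/cvgrPdist_le => e e0; near=> n.
rewrite distrC.
under eq_bigr do rewrite mulrC.
apply: le_trans (riemann_sum (L := L) n (pi_ge0 R) dF (der_bessel_integrand k z) _) _.
  move=> p; apply: le_trans (ler_normB _ _) _; apply: lerD.
    rewrite mulNr normrN -!mulrA normrM ler_piMr//.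
    rewrite !normrM mulr_ile1 ?mulr_ge0 ?cos_max//.
    by rewrite mulr_ile1 ?cos_max ?sin_max.
  rewrite normrM ger0_norm ?mulr_ge0// ler_piMr ?mulr_ge0//.
  by rewrite normrM mulr_ile1 ?cos_max ?sin_max.
rewrite ler_pdivrMr ?ltr0n//.
have : L * pi ^+ 2 / e <= n%:R by near: n; exact: nbhs_infty_ger.
by rewrite ler_pdivrMr// mulrC -natr1; lra.
Unshelve. all: by end_near. Qed.
End RiemannSums.

(** * Integration against a finite measure *)

Section MeasureFacts.
Variable R : realType.

(** Every point outside the support lies in a null interval with rational end
points, and there are countably many of these. *)
Lemma measure_lt_support (nu : {measure set (measurableTypeR R) -> \bar R}) (a : R) :
  measure_support nu `<=` `[a, +oo[ -> nu `]-oo, a[%classic = 0%E.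
Proof.
move=> supp.
pose I (pq : rat * rat) : set R := `]ratr pq.1, ratr pq.2[%classic.
pose J (n : nat) : set R :=
  if choice.unpickle n is Some pq
  then (if nu (I pq) == 0%E then I pq else set0) else set0.
have Jnull : nu.-negligible (\bigcup_n J n)%classic.
  apply: negligible_bigcup => n; rewrite /J.
  case: choice.unpickle => [pq|]; last exact: negligible_set0.
  case: eqP => [pq0|_]; last exact: negligible_set0.
  by exists (I pq); split=> //; exact: measurable_itv.
have : nu.-negligible `]-oo, a[%classic.
  apply: negligibleS Jnull.
  move=> x /=; rewrite in_itv/= => xa.
  have : ~ measure_support nu x by move=> /supp /=; rewrite in_itv/= andbT leNgt xa.
  move=> /existsNP[U /not_implyP[oU /not_implyP[Ux /negP nuU]]].
  have [e /= e0 eU] := open_nbhs_nbhs (conj oU Ux).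
  have xe1 : x - e < x by rewrite ltrBlDr ltrDl.
  have xe2 : x < x + e by rewrite ltrDl.
  have [p] := rat_in_itvoo xe1; have [q] := rat_in_itvoo xe2.
  rewrite !in_itv/= => /andP[xq qe] /andP[ep px].
  refine (ex_intro2 _ _ (choice.pickle (p, q)) Logic.I _).
  rewrite /J choice.pickleK.
  have Ipq : I (p, q) `<=` U.
    move=> y; rewrite /I /= in_itv/= => /andP[py yq]; apply: eU => /=.
    by rewrite ltr_norml; lra.
  suff -> : nu (I (p, q)) == 0%E by rewrite /I/= in_itv/= px.
  rewrite eq_le measure_ge0 andbT; apply: le_trans (_ : nu U <= 0)%E.
    apply: le_measure => //; apply/mem_set; first exact: measurable_itv.
    exact: open_measurable.
  by rewrite leNgt.
by move=> /negligibleP; apply; exact: measurable_itv.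
Qed.

Variable nu : {finite_measure set (measurableTypeR R) -> \bar R}.

Lemma integrable_bounded (E : set (measurableTypeR R)) (f : R -> R) (M : R) :
  measurable E -> measurable_fun E f -> (forall x, E x -> `|f x| <= M) ->
  nu.-integrable E (EFin \o f).
Proof.
move=> mE mf fM; apply: measurable_bounded_integrable => //.
  by rewrite ltey_eq fin_num_measure.
exists M; split; rewrite ?num_real// => x Mx y Ey.
exact: le_trans (fM y Ey) (ltW Mx).
Qed.

Lemma Rintegral_bound (E : set (measurableTypeR R)) (f : R -> R) (M : R) :
  measurable E -> measurable_fun E f -> (forall x, E x -> `|f x| <= M) ->
  `|\int[nu]_(x in E) f x| <= M * fine (nu E).
Proof.
move=> mE mf fM.
apply: le_trans (le_normr_Rintegral _ (integrable_bounded mE mf fM)) _ => //.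
rewrite -Rintegral_cst//; apply: le_Rintegral => //.
- apply: (@integrable_bounded _ _ M) => //; first exact: measurableT_comp.
  by move=> x Ex; rewrite normr_id fM.
- exact: finite_measure_integrable_cst.
Qed.

Lemma Rintegral_cvg (E : set (measurableTypeR R)) (f_ : nat -> R -> R)
    (f : R -> R) (M : R) :
  measurable E -> (forall n, measurable_fun E (f_ n)) ->
  (forall n x, E x -> `|f_ n x| <= M) ->
  (forall x, E x -> f_ n x @[n --> \oo] --> f x) ->
  measurable_fun E f /\
  \int[nu]_(x in E) f_ n x @[n --> \oo] --> \int[nu]_(x in E) f x.
Proof.
move=> mE mf fM ff.
have mf' : measurable_fun E f by apply: measurable_fun_cvg mf ff.
split => //.
have [] := @dominated_convergence _ _ R nu E mE (fun n => EFin \o f_ n)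
  (EFin \o f) (cst M%:E).
- by move=> n; apply/measurable_EFinP; exact: mf.
- exact/measurable_EFinP.
- by apply: aeW => x Ex; apply: cvg_EFin; [exact: nearW|exact: ff].
- exact: finite_measure_integrable_cst.
- by apply: aeW => x n Ex; rewrite lee_fin fM.
move=> If _ cv; apply: fine_cvg.
rewrite fineK; first exact: cv.
exact: integrable_fin_num.
Qed.

Lemma Rintegral_null (D N : set (measurableTypeR R)) (f : R -> R) :
  measurable D -> measurable N -> [disjoint D & N] -> nu N = 0%E ->
  measurable_fun (D `|` N) f ->
  \int[nu]_(x in D `|` N) f x = \int[nu]_(x in D) f x.
Proof.
move=> mD mN DN N0 mf; rewrite /Rintegral integral_setU_EFin//.
rewrite [X in (_ + X)%E]null_set_integral ?adde0//.
apply/measurable_EFinP; apply: measurable_funS mf; first exact: measurableU.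
exact: subsetUr.
Qed.
End MeasureFacts.

(** * Negative cosine coefficients of the chord function *)

Section Conclusion.
Variable R : realType.

Lemma limsup_pos_frequently (f : R -> R) :
  (0 < limf_esup (fun r => `|f r|%:E) (pinfty_nbhs R))%E ->
  exists2 d, 0 < d & forall r0, exists2 r, r0 < r & d < `|f r|.
Proof.
rewrite /limf_esup; set L := ereal_inf _ => L0.
have [d d0 dL] : exists2 d : R, 0 < d & (d%:E < L)%E.
  case: L L0 => [l| |//]; rewrite ?lte_fin => l0.
    by exists (l / 2); rewrite ?lte_fin; lra.
  by exists 1; rewrite ?ltr01// ltry.
exists d => // r0.
have : (d%:E < ereal_sup [set `|f r|%:E | r in [set r : R | (r0 < r)%R]])%E.
  apply: lt_le_trans dL _; apply: ereal_inf_lbound.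
  exists [set r : R | r0 < r] => //.
  by exists r0; split; rewrite ?num_real.
move=> /ereal_sup_gt[_ [r rr0 <-]]; rewrite lte_fin => dr.
by exists r.
Qed.

Variable nu : {finite_measure set (measurableTypeR R) -> \bar R}.

Lemma Rintegral_sum (E : set (measurableTypeR R)) (n : nat) (f : 'I_n -> R -> R) (M : R) :
  measurable E -> (forall i, measurable_fun E (f i)) ->
  (forall i x, E x -> `|f i x| <= M) ->
  \int[nu]_(x in E) (\sum_i f i x) = \sum_i \int[nu]_(x in E) f i x.
Proof.
move=> mE mf fM.
have If i : nu.-integrable E (EFin \o f i).
  by apply: (@integrable_bounded R nu E (f i) M) => // x Ex; exact: fM.
rewrite /Rintegral sum_fine; last first.
  by move=> i _; apply: integrable_fin_num => //; exact: If.
rewrite -(integral_sum mE If).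
by congr fine; apply: eq_integral => x _; rewrite sumEFin.
Qed.

(** The integrand of the transform [h], up to a constant factor. *)
Definition wave (r s : R) : R := cos (2 * r * s - pi / 4) / Num.sqrt s.

Lemma measurable_wave (r : R) :
  measurable_fun (`[(0 : R), +oo[%classic : set (measurableTypeR R)) (wave r).
Proof.
have -> : `[(0 : R), +oo[%classic = [set 0] `|` `]0, +oo[ by rewrite setU1itv.
apply/measurable_funU => //; split.
  exact: measurable_fun_set1.
apply: open_continuous_measurable_fun => // s.
move=> /set_mem; rewrite /= in_itv/= andbT => s0.
have cc : {for s, continuous (fun s : R => cos (2 * r * s - pi / 4))}.
  apply: (@der_cont R _ s (2 * r * - sin (2 * r * s - pi / 4))).
  by der_tac; ring.
have ci : {for s, continuous (fun s : R => (Num.sqrt s)^-1)}.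
  apply: continuousV; first by rewrite gt_eqF// sqrtr_gt0.
  exact: sqrt_continuous.
exact: cvgM cc ci.
Qed.

Variable a : R.
Hypothesis a0 : 0 < a.
Hypothesis nua : nu `]-oo, a[%classic = 0%E.

Let E : set (measurableTypeR R) := `[a, +oo[%classic.
Let mE : measurable E. Proof. exact: measurable_itv. Qed.

Lemma Rintegral_support (f : R -> R) :
  measurable_fun (`[(0 : R), +oo[%classic : set (measurableTypeR R)) f ->
  \int[nu]_(u in `[(0 : R), +oo[) f u = \int[nu]_(u in E) f u.
Proof.
move=> mf.
have DE : `[(0 : R), +oo[%classic = E `|` `[0, a[%classic.
  by rewrite setUC /E -itv_bndbnd_setU// bnd_simp ltW.
rewrite DE in mf *; apply: Rintegral_null => //.
  apply/disj_set2P/seteqP; split => // x [].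
  by rewrite /E /= !in_itv/= andbT => ax /andP[_]; rewrite ltNge ax.
apply/eqP; rewrite eq_le measure_ge0 andbT -nua.
apply: le_measure; [apply/mem_set; exact: measurable_itv| |].
  by apply/mem_set; exact: measurable_itv.
by move=> x /=; rewrite !in_itv/= => /andP[].
Qed.

Lemma wave_bound (r s : R) : E s -> `|wave r s| <= (Num.sqrt a)^-1.
Proof.
rewrite /E/= in_itv/= andbT => as_.
have sa : 0 < Num.sqrt a by rewrite sqrtr_gt0.
have ss : Num.sqrt a <= Num.sqrt s by apply: ler_wsqrtr.
rewrite /wave normrM -[leRHS]mul1r ler_pM ?cos_max//.
by rewrite ger0_norm ?invr_ge0 ?sqrtr_ge0// lef_pV2// posrE (lt_le_trans sa).
Qed.

Lemma measurable_cosM (D : set (measurableTypeR R)) (t : R) :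
  measurable_fun D (fun u => cos (t * u)).
Proof.
apply: measurable_funTS; apply: continuous_measurable_fun.
apply: (@continuous_of_der _ _ (fun u => t * - sin (t * u))) => u.
by der_tac; ring.
Qed.

(** The Riemann sums in the angle are not uniformly close to their limit for
unbounded [u], but they are bounded by [pi], and dominated convergence in [u]
applies. *)
Lemma coefficient_cvg (g : R -> R) (r : R) (k : nat) : 0 <= r ->
  (forall t, 0 <= t -> g t = \int[nu]_(u in `[(0 : R), +oo[) cos (t * u)) ->
  exists B : R -> R, [/\ measurable_fun E B,
    forall u, exists2 F, primitive_of (bessel_integrand k (2 * r * u)) F &
      B u = F pi - F 0 &
    (pi / n.+1%:R * \sum_(i < n.+1)
        cos (2 * k%:R * node R i) * g (2 * r * sin (node R i))) @[n --> \oo] --> \int[nu]_(u in E) B u].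
Proof.
move=> r0 gE.
have [F dF] := choice (fun z : R => bessel_primitive k z).
pose B u := F (2 * r * u) pi - F (2 * r * u) 0.
pose h n (i : 'I_n.+1) (u : R) :=
  pi / n.+1%:R * cos (2 * k%:R * node R i) * cos (2 * r * sin (node R i) * u).
pose S n (u : R) := \sum_(i < n.+1) h n i u.
have p0 := pi_ge0 R.
have hb n (i : 'I_n.+1) u : `|h n i u| <= pi / n.+1%:R.
  rewrite /h -mulrA normrM ger0_norm ?divr_ge0// ler_piMr ?divr_ge0//.
  by rewrite normrM mulr_ile1 ?cos_max.
have mh n (i : 'I_n.+1) : measurable_fun E (h n i).
  by apply: measurable_funM; [exact: measurable_cst|exact: measurable_cosM].
have SB u : E u -> S n u @[n --> \oo] --> B u.
  move=> _; have := bessel_riemann (dF (2 * r * u)).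
  apply: cvg_trans; apply: near_eq_cvg; near=> n.
  rewrite /S mulr_sumr; apply: eq_bigr => i _; rewrite /h mulrA; congr (_ * cos _).
  ring.
have [mB IB] : measurable_fun E B /\
    \int[nu]_(x in E) S n x @[n --> \oo] --> \int[nu]_(x in E) B x.
  apply: (@Rintegral_cvg _ _ _ _ _ pi) => //.
  - by move=> n; apply: measurable_sum => i; exact: mh.
  - move=> n u _; apply: le_trans (ler_norm_sum _ _ _) _.
    apply: le_trans (_ : \sum_(i < n.+1) pi / n.+1%:R <= _).
      by apply: ler_sum => i _; exact: hb.
    by rewrite sumr_const card_ord -[leLHS]mulr_natr divfK// pnatr_eq0.
exists B; split => //; first by move=> u; exists (F (2 * r * u)).
apply: cvg_trans IB; apply: near_eq_cvg; near=> n.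
rewrite /S (@Rintegral_sum _ _ _ (pi / n.+1%:R))//.
rewrite mulr_sumr; apply: eq_bigr => i _.
rewrite gE ?mulr_ge0 ?sin_node_ge0// Rintegral_support; last exact: measurable_cosM.
rewrite /h RintegralZl//; last first.
  apply: (@integrable_bounded _ _ _ _ 1) => //; first exact: measurable_cosM.
  by move=> x _; exact: cos_max.
by rewrite mulrA.
Unshelve. all: by end_near. Qed.

(** [cos z + sin z] is proportional to [cos (z - pi / 4)]. *)
Lemma wave_bessel (c r u : R) : 0 < r -> 0 < u ->
  c * (cos (2 * r * u) + sin (2 * r * u)) / Num.sqrt (2 * r * u) =
  c / (cos (pi / 4) * Num.sqrt 2) / Num.sqrt r * wave r u.
Proof.
move=> r0 u0; have p0 := pi_gt0 R.
have k0 : 0 < cos (pi / 4) :> R by apply: cos_gt0_pihalf; lra.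
have sk : sin (pi / 4) = cos (pi / 4) :> R.
  by rewrite -[LHS]cosBpihalf -[RHS]cosN; congr cos; field.
have s2 : 0 < Num.sqrt 2 :> R by rewrite sqrtr_gt0.
have sr : 0 < Num.sqrt r by rewrite sqrtr_gt0.
have su : 0 < Num.sqrt u by rewrite sqrtr_gt0.
rewrite /wave cosB sk !sqrtrM ?mulr_ge0 ?ltW//; field.
by rewrite !lt0r_neq0.
Qed.

(** The integral of [B] is [(-1)^k * c1 * psi r / sqrt r] up to [Q / r], where
[psi] is proportional to [h]; along radii where [|psi r|] stays above [d] the
main term dominates once [sqrt r] exceeds [Q / (|c1| * d)], and its sign is that
of [(-1)^k * c1 * psi r]. *)
Lemma bessel_integral_negative (m : nat) : (0 < l_limsup nu)%E ->
  exists2 r, 0 < r & exists b : bool, forall k B, (k <= m)%N -> odd k = b ->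
    measurable_fun E B ->
    (forall u, exists2 F, primitive_of (bessel_integrand k (2 * r * u)) F &
       B u = F pi - F 0) ->
    \int[nu]_(u in E) B u < 0.
Proof.
rewrite /l_limsup => /limsup_pos_frequently[d0 d00 freq].
have [c [M [c0 M0 asym]]] := bessel_asymptotics R.
pose psi r := \int[nu]_(u in E) wave r u.
have [d dpos dfreq] : exists2 d, 0 < d & forall r0, exists2 r, r0 < r & d < `|psi r|.
  pose C := (2 * (pi : R) `^ (3 / 2))^-1.
  exists (d0 / (`|C| + 1)); first by rewrite divr_gt0// ltr_wpDl.
  move=> r0; have [r rr0 dr] := freq r0; exists r => //.
  rewrite ltr_pdivrMr ?ltr_wpDl//; apply: lt_le_trans dr _.
  rewrite /h_transform -/C normrM Rintegral_support; last exact: measurable_wave.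
  by rewrite mulrC ler_wpM2l// lerDl.
have k0 : 0 < cos (pi / 4) :> R.
  by apply: cos_gt0_pihalf; have := pi_gt0 R; lra.
pose c1 := c / (cos (pi / 4) * Num.sqrt 2).
have c10 : 0 < `|c1|.
  by rewrite normr_gt0 !mulf_neq0// invr_neq0// mulf_neq0// lt0r_neq0// sqrtr_gt0.
pose V := fine (nu E).
have V0 : 0 <= V by rewrite fine_ge0.
pose Q := M * (m%:R + 1) ^+ 2 / (2 * a) * V.
have Q0 : 0 <= Q.
  by rewrite mulr_ge0// divr_ge0 ?mulr_ge0 ?sqr_ge0// ltW// mulr_gt0.
pose T := Q / (`|c1| * d).
have T0 : 0 <= T by rewrite divr_ge0// mulr_ge0// ltW.
(* 128 / a brings the arguments 2 r u into the asymptotic range of the Bessel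
   functions, T^2 makes the main term dominate *)
have [r rr0 dr] := dfreq (128 / a + T ^+ 2).
have a128 : 0 < 128 / a by rewrite divr_gt0.
have ra : 128 < r * a by rewrite -ltr_pdivrMr//; have := sqr_ge0 T; lra.
have r0 : 0 < r by have := sqr_ge0 T; lra.
have sr0 : 0 < Num.sqrt r by rewrite sqrtr_gt0.
have sr2 : Num.sqrt r ^+ 2 = r by rewrite sqr_sqrtr// ltW.
have Tr : T < Num.sqrt r by rewrite -ltr_sqr ?nnegrE ?(ltW sr0)// sr2; lra.
exists r => //; exists (0 < c1 * psi r) => k B km kb mB BE.
pose s : R := (-1) ^+ k * c1 / Num.sqrt r.
pose bnd := M * (m%:R + 1) ^+ 2 / (2 * r * a).
have close u : E u -> `|B u - s * wave r u| <= bnd.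
  rewrite /E /= in_itv/= andbT => au.
  have u0 : 0 < u by apply: lt_le_trans au.
  have [F dF ->] := BE u.
  have rau : r * a <= r * u by rewrite ler_pM2l.
  have z256 : 256 <= 2 * r * u by lra.
  have := asym k (2 * r * u) F z256 dF.
  have -> : (-1) ^+ k * c * (cos (2 * r * u) + sin (2 * r * u)) / Num.sqrt (2 * r * u)
      = s * wave r u.
    transitivity ((-1) ^+ k *
        (c * (cos (2 * r * u) + sin (2 * r * u)) / Num.sqrt (2 * r * u))).
      by rewrite !mulrA.
    by rewrite wave_bessel// /s -/c1 !mulrA.
  move=> H.
  apply: le_trans H _; apply: ler_pM.
  - by rewrite mulr_ge0 ?sqr_ge0.
  - by rewrite invr_ge0; lra.
  - by rewrite ler_wpM2l// lerXn2r ?nnegrE ?addr_ge0// lerD2r ler_nat.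
  - by rewrite lef_pV2 ?posrE; lra.
have mwave : measurable_fun E (wave r).
  apply: measurable_funS (measurable_wave r); first exact: measurable_itv.
  by rewrite /E => u /=; rewrite !in_itv/= !andbT; apply: le_trans; exact: ltW.
have msw : measurable_fun E (fun u => s * wave r u).
  by apply: measurable_funM => //; exact: measurable_cst.
have swb u : E u -> `|s * wave r u| <= `|s| * (Num.sqrt a)^-1.
  by move=> Eu; rewrite normrM ler_wpM2l// wave_bound.
have IB : nu.-integrable E (EFin \o B).
  apply: (@integrable_bounded _ _ _ _ (bnd + `|s| * (Num.sqrt a)^-1)) => // u Eu.
  have := close u Eu; have := swb u Eu.
  by have := ler_normD (B u - s * wave r u) (s * wave r u); rewrite subrK; lra.
have Iw : nu.-integrable E (EFin \o wave r).
  by apply: (@integrable_bounded _ _ _ _ (Num.sqrt a)^-1) => // u; exact: wave_bound.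
have Isw : nu.-integrable E (EFin \o (fun u => s * wave r u)).
  exact: (@integrable_bounded _ _ _ _ (`|s| * (Num.sqrt a)^-1)).
have := @Rintegral_bound _ nu E (fun u => B u - s * wave r u) bnd mE
  (measurable_funB mB msw) close.
rewrite RintegralB// RintegralZl// -/(psi r) -/V.
have -> : bnd * V = Q / Num.sqrt r / Num.sqrt r.
  rewrite -mulrA -invfM -expr2 sr2 /bnd /Q; field.
  by rewrite !lt0r_neq0.
have sE : s * psi r = - (`|c1| * `|psi r|) / Num.sqrt r.
  rewrite /s -signr_odd kb -normrM; case: ltP => h.
    by rewrite expr1 gtr0_norm//; ring.
  by rewrite expr0 ler0_norm//; ring.
rewrite sE => /(le_trans (ler_norm _)).
have isr : 0 < (Num.sqrt r)^-1 by rewrite invr_gt0.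
have QT : Q / Num.sqrt r < `|c1| * d.
  by rewrite ltr_pdivrMr// mulrC -ltr_pdivrMr// mulr_gt0.
have : `|c1| * d < `|c1| * `|psi r| by rewrite ltr_pM2l.
set x := Q / Num.sqrt r in QT *; set y := `|c1| * d in QT *; set w := `|c1| * _.
set v := (Num.sqrt r)^-1 in isr *.
move=> yw; nra.
Qed.
End Conclusion.

Unset Implicit Arguments.

Theorem proposition5p8 (R : realType)
  (nu : {finite_measure set (measurableTypeR R) -> \bar R})
  (nu_nonneg : nu [set u : R | u < 0] = 0%E)
  (g : R -> R)
  (g_def : forall t : R, 0 <= t ->
    g t = \int[nu]_(u in `[(0 : R), +oo[) cos (t * u))
  (supp_nu : exists a : R, 0 < a /\ measure_support nu `<=` `[a, +oo[)
  (l_pos : (0 < l_limsup nu)%E) :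
  kappa_minus 2 g = +oo%E.
Proof.
have [a [a0 supp]] := supp_nu.
have nua := measure_lt_support supp.
apply/eqyP => A A0; pose K1 := Num.bound A.
have AK : A <= K1%:R by exact/ltW/archi_boundP/ltW.
have [r r0 [b neg]] := bessel_integral_negative a0 nua (2 * K1) l_pos.
(* the K1 smallest positive integers of the parity b *)
pose ks (i : 'I_K1) := (2 * i + ~~ b).+1.
have ksb i : odd (ks i) = b by rewrite /ks /= oddD oddM/=; case: (b).
have ksK i : (ks i <= 2 * K1)%N by rewrite /ks; have := ltn_ord i; case: (b) => /=; lia.
pose coef n (i : 'I_K1) : R := pi / n.+1%:R * \sum_(j < n.+1)
  cos (2 * (ks i)%:R * node R j) * g (2 * r * sin (node R j)).
have eventually_neg i : \forall n \near \oo, coef n i < 0.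
  have [B [mB BE cB]] := coefficient_cvg a0 nua (ks i) (ltW r0) g_def.
  exact: (cvgr_lt _ cB _ (neg (ks i) B (ksK i) (ksb i) mB BE)).
have all_neg := filter_forall _ eventually_neg.
near \oo => n.
have n4 : (4 * K1 <= n)%N by near: n; exact: nbhs_infty_ge.
have negn : forall i, coef n i < 0 by near: n; exact: all_neg.
have ks_inj : injective ks.
  by move=> i j; rewrite /ks => -[] /addIn /eqP; rewrite eqn_mul2l/= => /eqP/val_inj.
have [] := @polygon_negative R n g r K1 ks r0 ks_inj.
- by [].
- by move=> i; have := ksK i; lia.
- move=> i; have := negn i; rewrite /coef pmulr_rlt0// divr_gt0 ?pi_gt0//.
move=> x_inj Kneg; apply: le_trans (_ : K1%:R%:E <= _)%E; first by rewrite lee_fin.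
pose A_n := schoenberg_mx g (@vertex R n r).
apply: le_trans (_ : (num_neg_eigenvalues A_n)%:R%:E <= _)%E.
  by rewrite lee_fin ler_nat.
by apply: ereal_sup_ubound; exists n.+1, (@vertex R n r).
Unshelve. all: by end_near. Qed.
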